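(* Let $N\ge3$, let $\Omega\subset\mathbb{R}^N$ be an open set, let $1<p<\infty$ and let $f\in W^{-1,2}(\Omega)\setminus\{0\}$. Let $u_0$ be the unique minimizer of $J_{p,f}$, and let $$U_0=\left(\int_\Omega|u_0|^{2p/(p+1)}\,dx\right)^{1/p}|u_0|^{-2/(p+1)}$$ (the unique minimizer of $\mathcal{E}_f(V)$ among Borel measurable $V\ge0$ with $\int_\Omega V^{-p}\,dx\le1$). Suppose that $$c_4:=\left\||u_0|^{(p-1)/(p+1)}\right\|_{L^{(2^* )'}(\Omega)}<+\infty,$$ where $2^*=2N/(N-2)$ and $(2^* )'=2N/(N+2)$. Then for every positive Borel measurable potential $V:\Omega\to(0,+\infty]$ such that $\|1/V\|_{L^p(\Omega)}\le1$ we have $$\mathcal{E}_f(V)-\mathcal{E}_f(U_0)\ge\sigma_m\left\|\frac1V-\frac1{U_0}\right\|^{2p(p+1)/(p-1)}_{L^p(\Omega)},$$ for a constant $\sigma_m>0$ depending only on $N$, $p$, $c_2$, $c_4$ and $\|f\|_{W^{-1,2}(\Omega)}$, where $c_2=\|u_0\|_{L^{2p/(p+1)}(\Omega)}=\left(\int_\Omega|u_0|^{2p/(p+1)}\,dx\right)^{(p+1)/(2p)}$.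
   Context: $W^{1,2}_0(\Omega)$ is the homogeneous Sobolev space, i.e. the closure (completion) of $C^\infty_0(\Omega)$ with respect to the norm $\|u\|_{W^{1,2}_0(\Omega)}=(\int_\Omega|\nabla u|^2\,dx)^{1/2}$; $W^{-1,2}(\Omega)$ is its dual and $\langle\cdot,\cdot\rangle$ the duality pairing. For a Borel measurable $V:\Omega\to[0,+\infty]$ the energy is $$\mathcal{E}_f(V)=\min_{u\in W^{1,2}_0(\Omega)}\ \frac12\int_\Omega|\nabla u|^2\,dx+\frac12\int_\Omega Vu^2\,dx-\langle f,u\rangle$$ (the functional may take the value $+\infty$; $+\infty\cdot0=0$). Define for $u\in W^{1,2}_0(\Omega)$ $$J_{p,f}(u)=\frac12\int_\Omega|\nabla u|^2\,dx+\frac12\left(\int_\Omega|u|^{2p/(p+1)}\,dx\right)^{(p+1)/p}-\langle f,u\rangle,$$ with $J_{p,f}(u)=+\infty$ if $u\notin L^{2p/(p+1)}(\Omega)$; it has a unique minimizer. Where $u_0=0$ one has $U_0=+\infty$ and $1/U_0=0$; more generally $1/(+\infty)=0$. *)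

(* Defs.v *)
From HB Require Import structures.
From mathcomp Require Import all_boot all_order all_algebra.
From mathcomp Require Import all_classical all_reals all_analysis.
From mathcomp Require Import measurable_realfun.

Set Implicit Arguments.
Unset Strict Implicit.
Unset Printing Implicit Defensive.
Import Order.TTheory GRing.Theory Num.Theory.
Import numFieldNormedType.Exports.
Local Open Scope classical_set_scope.
Local Open Scope ring_scope.

(* Matrices, hence 'rV[R]_N, carry the Borel sigma-algebra. *)
HB.instance Definition _ (R : realType) (m n : nat) :=
  @isMeasurable.Build (sigma_display (@open 'M[R]_(m, n))) 'M[R]_(m, n)
    <<s @open 'M[R]_(m, n) >>
    (@sigma_algebra0 _ setT (@open 'M[R]_(m, n)))
    (@sigma_algebraC _ (@open 'M[R]_(m, n)))
    (@sigma_algebra_bigcup _ setT (@open 'M[R]_(m, n))).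

Section lebesgue_rV.
Context {R : realType}.

Lemma open_measurable_mx m n (A : set 'M[R]_(m, n)) : open A -> measurable A.
Proof. exact: sub_sigma_algebra. Qed.

Lemma continuous_measurable_fun_mx m n m' n'
    (f : 'M[R]_(m, n) -> 'M[R]_(m', n')) :
  continuous f -> measurable_fun setT f.
Proof.
move=> cf; apply: (measurability (@open 'M[R]_(m', n'))) => //.
move=> _ [B oB <-]; rewrite setTI.
by apply: open_measurable_mx; exact: open_comp.
Qed.

Lemma coord_measurable_mx m n i j :
  measurable_fun setT (fun A : 'M[R]_(m, n) => A i j).
Proof.
apply: (measurability (@RGenOpens.G R)).
  exact: RGenOpens.measurableE.
move=> _ [B [x [y ->]] <-]; rewrite setTI; apply: open_measurable_mx.
apply: open_comp; last exact: itv_open.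
by move=> A _; exact: coord_continuous.
Qed.

Lemma rV_rat_dense n (x : 'rV[R]_n) (e : R) : 0 < e ->
  exists q : 'rV[rat]_n, ball x e (map_mx ratr q).
Proof.
move=> e0.
have H (j : 'I_n) : {r : rat | ball (x 0 j) e (ratr r : R)}.
  apply: cid.
  have [|r] := @rat_in_itvoo R (x 0 j - e) (x 0 j + e).
    by rewrite ltrBlDr -addrA ltrDl addr_gt0.
  rewrite in_itv/= => /andP[r1 r2]; exists r.
  by rewrite /ball/= ltr_distlC r1 r2.
exists (\row_j sval (H j)); split=> // i j.
by rewrite !mxE ord1; exact: (svalP (H j)).
Qed.

Lemma open_measurable_prod_rV n (A : set (R * 'rV[R]_n)) :
  open A -> measurable A.
Proof.
move=> oA.
pose B (t : rat * 'rV[rat]_n * nat) : set (R * 'rV[R]_n) :=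
  ball (ratr t.1.1 : R) t.2.+1%:R^-1 `*`
  ball (map_mx ratr t.1.2 : 'rV[R]_n) t.2.+1%:R^-1.
pose C t := if `[< B t `<=` A >] then B t else set0.
suff -> : A = \bigcup_t C t.
  apply: countable_bigcupT_measurable => // t.
  rewrite /C; case: ifPn => // _; apply: measurableX.
    by apply: open_measurable; exact: ball_open.
  by apply: open_measurable_mx; exact: ball_open.
apply/seteqP; split => [[x y] Axy|[x y] [t _]]; last first.
  by rewrite /C; case: ifPn => [/asboolP + ?|//]; exact.
have /nbhs_ballP[e /= e0 eA] := open_nbhs_nbhs (conj oA Axy).
have [k ke] : exists k, k.+1%:R^-1 + k.+1%:R^-1 < e :> R.
  have := near_infty_natSinv_lt (PosNum (divr_gt0 e0 (@ltr0n R 2))).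
  move=> [k _ /(_ k (leqnn k))/= ke]; exists k.
  by rewrite [ltRHS](splitr e) ltrD.
have k0 : 0 < k.+1%:R^-1 :> R by rewrite invr_gt0.
have [|r] := @rat_in_itvoo R (x - k.+1%:R^-1) (x + k.+1%:R^-1).
  by rewrite ltrBlDr -addrA ltrDl addr_gt0.
rewrite in_itv/= => /andP[r1 r2].
have [q yq] := rV_rat_dense y k0.
exists ((r, q), k) => //; rewrite /C ifT.
  split => /=; apply: ball_sym => //.
  by rewrite /ball/= ltr_distlC r1 r2.
apply/asboolP => -[x' y'] [/= xr yr]; apply: eA; split => /=.
  apply: (@le_ball _ _ _ _ _ (ltW ke)); apply: ball_triangle xr.
  by rewrite /ball/= ltr_distlC r1 r2.
by apply: (@le_ball _ _ _ _ _ (ltW ke)); exact: ball_triangle yq yr.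
Qed.

Definition cons_rV n (t : R * 'rV[R]_n) : 'rV[R]_n.+1 :=
  row_mx (const_mx t.1 : 'rV[R]_1) t.2.

Definition uncons_rV n (x : 'rV[R]_n.+1) : R * 'rV[R]_n :=
  (x 0 0, rsubmx (x : 'rV[R]_(1 + n))).

Lemma uncons_rVK n : cancel (@cons_rV n) (@uncons_rV n).
Proof.
move=> [a y]; rewrite /uncons_rV /cons_rV row_mxKr; congr pair.
have -> : (0 : 'I_n.+1) = lshift n (0 : 'I_1) by exact/val_inj.
by rewrite (@row_mxEl _ 1 1 n) mxE.
Qed.

Lemma measurable_cons_rV n : measurable_fun setT (@cons_rV n).
Proof.
apply: (measurability (@open 'rV[R]_n.+1)) => //.
move=> _ [B oB <-]; rewrite setTI; apply: open_measurable_prod_rV.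
apply: open_comp oB => -[x y] _ A /= /nbhs_ballP[e /= e0 eA].
apply/nbhs_ballP; exists e => //= -[x' y'] [/= xx' yy']; apply: eA.
split=> // i j; rewrite /cons_rV.
by case: (split_ordP (j : 'I_(1 + n))) => k ->;
  rewrite ?(@row_mxEl _ 1 1 n) ?(@row_mxEr _ 1 1 n) ?mxE//; exact: yy'.2.
Qed.

Lemma measurable_uncons_rV n : measurable_fun setT (@uncons_rV n).
Proof.
apply: measurable_fun_pair; first exact: coord_measurable_mx.
apply: continuous_measurable_fun_mx => x A /= /nbhs_ballP[e /= e0 eA].
apply/nbhs_ballP; exists e => //= y [_ xy]; apply: eA; split=> // i j.
by rewrite !mxE; exact: xy.
Qed.

(* Lebesgue measure on R^0 is the Dirac mass; on R^(n+1) it is the product of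
   the Lebesgue measures on R and R^n, transported to row vectors. *)
Section step.
Variables (n : nat) (mu : {sigma_finite_measure set 'rV[R]_n -> \bar R}).

Definition lebesgue_rV_step : set 'rV[R]_n.+1 -> \bar R :=
  pushforward (lebesgue_measure \x mu)%E (@cons_rV n).

Let step_measure : {measure set 'rV[R]_n.+1 -> \bar R} :=
  measure_function_pushforward__canonical__measure_function_Measure
    (lebesgue_measure \x mu)%E (@measurable_cons_rV n).
HB.instance Definition _ := Measure.copy lebesgue_rV_step step_measure.

Lemma lebesgue_rV_step_sigma_finite : sigma_finite setT lebesgue_rV_step.
Proof.
have /sigma_finiteP[F [TF ndF Foo]] := sigma_finiteT (@lebesgue_measure R).
have /sigma_finiteP[G [TG ndG Goo]] := sigma_finiteT mu.
exists (fun k => @uncons_rV n @^-1` (F k `*` G k)).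
  rewrite -preimage_bigcup -[LHS](preimage_setT (@uncons_rV n)); congr (_ @^-1` _).
  apply/seteqP; split => // -[x y] _.
  have [[k _ Fx] [l _ Gy]] : (\bigcup_k F k) x /\ (\bigcup_k G k) y.
    by rewrite -TF -TG.
  exists (maxn k l) => //; split.
    by move: x Fx; exact/subsetPset/ndF/leq_maxl.
  by move: y Gy; exact/subsetPset/ndG/leq_maxr.
move=> k; have [mF Fk] := Foo k; have [mG Gk] := Goo k; split.
  rewrite -[X in measurable X]setTI; apply: measurable_uncons_rV => //.
  exact: measurableX.
rewrite /lebesgue_rV_step /pushforward -comp_preimage.
have -> : @uncons_rV n \o @cons_rV n = id.
  by apply/funext => t /=; rewrite uncons_rVK.
rewrite preimage_id product_measure1E//.
by rewrite lte_mul_pinfty// ge0_fin_numE.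
Qed.
HB.instance Definition _ := Measure_isSigmaFinite.Build _ _ _ lebesgue_rV_step
  lebesgue_rV_step_sigma_finite.
End step.

Fixpoint lebesgue_rV (n : nat) : {sigma_finite_measure set 'rV[R]_n -> \bar R} :=
  if n is n'.+1 then lebesgue_rV_step (lebesgue_rV n') else \d_(0 : 'rV[R]_0).

Lemma lebesgue_rV_box n (A : 'I_n -> set R) : (forall i, measurable (A i)) ->
  lebesgue_rV n [set x | forall i, A i (x 0 i)]
  = (\prod_(i < n) lebesgue_measure (A i))%E.
Proof.
elim: n A => [|n IHn] A mA.
  by rewrite big_ord0 /= diracE mem_set// => -[].
rewrite big_ord_recl /= /lebesgue_rV_step /pushforward.
rewrite -IHn// -product_measure1E//; last first.
- rewrite [X in _ X](_ : _ =
    \bigcap_i [set x : 'rV[R]_n | A (lift ord0 i) (x 0 i)]).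
    apply: fin_bigcap_measurable => // i _; rewrite -[X in measurable X]setTI.
    exact: coord_measurable_mx.
  by apply/seteqP; split => x /= Ax i; [move=> _|]; exact: Ax.
- exact: mA.
have c0 (t : R * 'rV[R]_n) : cons_rV t 0 ord0 = t.1.
  by rewrite -[in RHS](uncons_rVK t).
have cS (t : R * 'rV[R]_n) i : cons_rV t 0 (lift ord0 i) = t.2 0 i.
  have -> : lift ord0 i = rshift 1 i by exact/val_inj.
  by rewrite /cons_rV (@row_mxEr _ 1 1 n).
congr product_measure1; apply/seteqP; split => [t /= At|t /= [At1 At2] i].
  by split => [|i]; [rewrite -c0|rewrite -cS]; exact: At.
by have [j ->|->] := unliftP ord0 i; rewrite ?c0// cS.
Qed.

End lebesgue_rV.

Section sobolev.
Context {R : realType} {N : nat}.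
Local Notation E := 'rV[R]_N.
Local Notation mu := (lebesgue_rV N).
Implicit Types (Omega : set E) (u : E -> R) (f : (E -> R) -> R).

Definition partial (i : 'I_N) u : E -> R := fun x => 'D_(delta_mx 0 i) u x.

Definition iter_partial (s : seq 'I_N) u : E -> R := foldr partial u s.

Definition smooth u := forall s : seq 'I_N,
  continuous (iter_partial s u) /\
  forall i x, derivable (iter_partial s u) x (delta_mx 0 i).

Definition support u : set E := closure [set x | u x != 0].

Definition test_function Omega u :=
  [/\ smooth u, compact (support u) & support u `<=` Omega].

Definition gradient u : E -> E := fun x => \row_i partial i u x.

(* Squared Euclidean norm; `|v| would be the sup norm on row vectors. *)
Definition sqnorm (v : E) : R := \sum_i v 0 i ^+ 2.

Definition Lp_norm Omega (q : R) (g : E -> \bar R) : \bar R :=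
  ('N[mu]_(q%:E)[g \_ Omega])%E.

Definition crit_exp : R := 2 * N%:R / (N%:R - 2).

Definition crit_exp_conj : R := 2 * N%:R / (N%:R + 2).

(* For N >= 3 the Sobolev inequality makes a sequence of test functions that is
   Cauchy for the L^2 norm of the gradient converge in L^(2N/(N-2)), and the
   limit function determines the element of the completion. Elements of
   W^{1,2}_0(Omega) are therefore represented by such limits u, and G is the
   L^2 limit of the gradients. Only values on Omega matter. *)
Definition sobolev0_gradient Omega u (G : E -> E) :=
  [/\ measurable_fun Omega u, measurable_fun Omega G &
   exists phi : nat -> E -> R, [/\ forall n, test_function Omega (phi n),
     (fun n => Lp_norm Omega crit_exp (fun x => (phi n x - u x)%:E))
       @ \oo --> 0%E &
     (fun n => \int[mu]_(x in Omega) (sqnorm (gradient (phi n) x - G x))%:E)%E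
       @ \oo --> 0%E]].

Definition sobolev0 Omega : set (E -> R) :=
  [set u | exists G, sobolev0_gradient Omega u G].

(* Determined almost everywhere on Omega when sobolev0 Omega u holds. *)
Definition weak_gradient Omega u : E -> E := get (sobolev0_gradient Omega u).

Definition dirichlet Omega u : \bar R :=
  (\int[mu]_(x in Omega) (sqnorm (weak_gradient Omega u x))%:E)%E.

Definition sobolev0_norm Omega u : \bar R := (dirichlet Omega u `^ 2^-1)%E.

Definition dual_norm Omega f : \bar R :=
  ereal_sup [set `|f u|%:E |
    u in [set u | sobolev0 Omega u /\ (sobolev0_norm Omega u <= 1)%E]].

(* Linearity and boundedness force f to agree on functions of sobolev0 Omega
   that are equal almost everywhere on Omega. The values of f outside
   sobolev0 Omega are irrelevant. *)
Definition sobolev0_dual Omega f :=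
  (forall (a : R) u v, sobolev0 Omega u -> sobolev0 Omega v ->
     f (fun x => a * u x + v x) = a * f u + f v) /\
  (dual_norm Omega f < +oo)%E.

Definition dual_nonzero Omega f := exists2 u, sobolev0 Omega u & f u != 0.

Definition energy_functional Omega f (V : E -> \bar R) u : \bar R :=
  ((2^-1)%:E * dirichlet Omega u
   + (2^-1)%:E * \int[mu]_(x in Omega) (V x * (u x ^+ 2)%:E) - (f u)%:E)%E.

(* The minimum is attained, so it is the infimum. *)
Definition energy Omega f (V : E -> \bar R) : \bar R :=
  ereal_inf [set energy_functional Omega f V u | u in sobolev0 Omega].

(* +oo when u is not in L^(2p/(p+1))(Omega), as +oo `^ r = +oo for r > 0. *)
Definition J_functional Omega (p : R) f u : \bar R :=
  ((2^-1)%:E * dirichlet Omega u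
   + (2^-1)%:E
     * (\int[mu]_(x in Omega) (`|u x| `^ (2 * p / (p + 1)))%:E)
       `^ ((p + 1) / p)
   - (f u)%:E)%E.

Definition is_minimizer_J Omega (p : R) f u0 :=
  sobolev0 Omega u0 /\
  forall v, sobolev0 Omega v ->
    (J_functional Omega p f u0 <= J_functional Omega p f v)%E.

(* The case u0 x = 0 is set apart because powR has 0 `^ r = 0 even for r < 0. *)
Definition optimal_potential Omega (p : R) u0 : E -> \bar R := fun x =>
  if u0 x == 0 then +oo%E else
  ((\int[mu]_(y in Omega) (`|u0 y| `^ (2 * p / (p + 1)))%:E) `^ (p^-1)
   * (`|u0 x| `^ (- (2 / (p + 1))))%:E)%E.

End sobolev.

(* Main.v *)
Require Import Defs.
From HB Require Import structures.
From mathcomp Require Import all_boot all_order all_algebra.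
From mathcomp Require Import all_classical all_reals all_analysis.
From mathcomp Require Import measurable_realfun.
From mathcomp Require Import ring lra.
Import Order.TTheory GRing.Theory Num.Theory.
Import numFieldNormedType.Exports.
Local Open Scope classical_set_scope.
Local Open Scope ring_scope.

Set Implicit Arguments.
Unset Strict Implicit.
Unset Printing Implicit Defensive.

(* Put q = 2p/(p+1), m = (u + u0)/2, W = 1/V and W0 = 1/U0. Minimality of u0
   gives, for every competitor u,
     F_V(u) - J(u0) >= F_V(u) + J(u0) - 2 J(m)
                    >= (\int V u^2 + \int U0 u0^2)/2 - ||m||_q^2,
   by convexity of the Dirichlet integral. Titu's inequality
   (u + u0)^2 <= (V u^2 + U0 u0^2)(W + W0) and Hoelder bound ||m||_q^2 by
   ||(W + W0)/2||_p times the first term, which is at least c2^2/2. Hence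
   E_f(V) - E_f(U0) >= (1 - ||(W + W0)/2||_p) c2^2/2, and uniform convexity of
   L^p bounds the right-hand side below by a constant times ||W - W0||_p^(2p).
   This is enough because 2p <= 2p(p+1)/(p-1) and ||W - W0||_p is bounded.

   Convexity of the Dirichlet integral needs the weak gradient to be unique: if
   test functions chi_n tend to 0 in L^(2N/(N-2)) and their gradients are Cauchy
   in L^2, integrating by parts against chi_m itself shows that
   \int grad chi_n . grad chi_m tends to 0 as n grows, so the limit of the
   gradients is 0. *)

(** * Uniform convexity of powers *)

(** The lower bound is proved for each competitor u separately and then passes to the infimum, so no
    minimizer of the functional for V enters. On the other side, int U0 u0^2 = c2^2 makes u0 a
    competitor of value J(u0) for U0, and E_f(U0) <= J(u0) is all that is used about E_f(U0). The
    midpoint suits both terms: f is linear and cancels, and the constraints on 1/V and 1/U0 meet in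
    their average. Two degeneracies shape the details. If c2 were 0, the factor a^(-1/p) in 1/U0 and
    the rate itself would break down; f != 0 excludes this, since J takes negative values along
    multiples of a test function. And V or the functional may be +oo: an infinite Dirichlet or
    potential term makes the bound trivial, and otherwise V u^2 is finite almost everywhere, which
    is enough for (V u^2) W = u^2. Uniform convexity avoids separate Clarkson inequalities for p
    below and above 2: the convexity deficit is bounded by the square of s = (a - b)/(a + b) with
    the constant min(1, (p - 1)^2), for all p > 1 at once. *)

Lemma bernoulli_powR {R : realType} (k x : R) : 1 <= k -> 0 <= x ->
  1 + k * (x - 1) <= x `^ k.
Proof.
move=> k1 x0; have k0 : 0 < k by lra.
have [->|k_neq1] := eqVneq k 1; first by rewrite powRr1//; lra.
have k_gt1 : 1 < k by rewrite lt_neqAle eq_sym k_neq1.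
(* Young's inequality for x and 1 with exponents k and k/(k - 1); multiplying by k gives the
   claim. *)
have : x * 1 <= x `^ k / k + 1 `^ (k / (k - 1)) / (k / (k - 1)).
  apply: conjugate_powR => //; first by rewrite divr_gt0// subr_gt0.
  by field; rewrite subr_eq0 k_neq1 gt_eqF.
rewrite powR1 mulr1 invf_div mul1r => h.
have := ler_wpM2l (ltW k0) h.
have -> : k * (x `^ k / k + (k - 1) / k) = x `^ k + (k - 1).
  by field; rewrite gt_eqF.
lra.
Qed.

(** This is the previous inequality for the exponent 1/k at the point x^k, solved for x^k. *)
Lemma le1_bernoulli_powR {R : realType} (k x : R) : 0 < k <= 1 -> 0 <= x ->
  x `^ k <= 1 + k * (x - 1).
Proof.
move=> /andP[k0 k1] x0.
have := @bernoulli_powR _ k^-1 (x `^ k).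
rewrite -powRrM divff ?gt_eqF// powRr1// => /(_ _ (powR_ge0 _ _)).
rewrite invf_ge1// => /(_ k1) h.
have := ler_wpM2l (ltW k0) h.
have -> : k * (1 + k^-1 * (x `^ k - 1)) = k + x `^ k - 1.
  by field; rewrite gt_eqF.
lra.
Qed.

(* For p <= 2 the lower bound x^p >= x^2 / (1 + (2 - p)(x - 1)) makes the
   symmetrised inequality rational; for p >= 2 apply Bernoulli to x^2. *)
Lemma powR_symmetric_convex {R : realType} (p s : R) : 1 < p -> 0 <= s <= 1 ->
  1 + Num.min 1 ((p - 1) ^+ 2) * s ^+ 2
  <= ((1 + s) `^ p + (1 - s) `^ p) / 2.
Proof.
move=> p1 /andP[s0 s1].
have s2 : s ^+ 2 <= 1 by rewrite expr_le1.
have [p2|p2] := leP p 2; last first.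
  have H x : 0 <= x -> 1 + p / 2 * (x ^+ 2 - 1) <= x `^ p.
    move=> x0; have -> : p = 2 * (p / 2) by field.
    rewrite powRrM -[2]/(2%:R) powR_mulrn//.
    have := @bernoulli_powR _ (p / 2) (x ^+ 2).
    rewrite sqr_ge0 => /(_ _ isT); rewrite (_ : 2 * (p / 2) / 2 = p / 2); last by field.
    by apply; lra.
  have := H (1 + s); have := H (1 - s).
  rewrite subr_ge0 s1 addr_ge0// => /(_ isT) h1 /(_ isT) h2.
  have : Num.min 1 ((p - 1) ^+ 2) * s ^+ 2 <= 1 * s ^+ 2.
    by apply: ler_wpM2r; [exact: sqr_ge0|rewrite ge_min lexx].
  nra.
set t := 2 - p.
have t01 : 0 <= t < 1 by rewrite /t; lra.
have H x : 0 <= x -> 0 < 1 + t * (x - 1) -> x ^+ 2 / (1 + t * (x - 1)) <= x `^ p.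
  move=> x0 tx.
  have [->|xn0] := eqVneq x 0; first by rewrite expr0n/= mul0r powR_ge0.
  have xp : 0 < x by rewrite lt_def xn0.
  rewrite ler_pdivrMr// -powR_mulrn//.
  (* Split x^2 = x^p x^t; the concave form of Bernoulli bounds x^t by the denominator. *)
  have -> : 2%:R = p + t :> R by rewrite /t; ring.
  rewrite powRD ?xn0 ?implybT// ler_wpM2l ?powR_ge0//.
  have [t0|t0] := eqVneq t 0; first by rewrite t0 powRr0; lra.
  by apply: le1_bernoulli_powR => //; case/andP: t01 => t1 /ltW ->; rewrite lt_def t0 t1.
have ts : 0 <= t * s < 1 by nra.
have d1 : 0 < 1 + t * s by lra.
have d2 : 0 < 1 - t * s by lra.
have d3 : 0 < 1 - (t * s) ^+ 2.
  by rewrite (_ : 1 - _ = (1 - t * s) * (1 + t * s)) ?mulr_gt0//; ring.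
have := H (1 + s); have := H (1 - s).
rewrite (_ : 1 - s - 1 = - s); last by ring.
rewrite (_ : 1 + s - 1 = s); last by ring.
rewrite mulrN subr_ge0 s1 addr_ge0// d1 d2 => /(_ isT isT) h1 /(_ isT isT) h2.
have : Num.min 1 ((p - 1) ^+ 2) * s ^+ 2 <= (p - 1) ^+ 2 * s ^+ 2.
  by apply: ler_wpM2r; [exact: sqr_ge0|rewrite ge_min lexx orbT].
suff : (p - 1) ^+ 2 * s ^+ 2 + 1
    <= ((1 + s) ^+ 2 / (1 + t * s) + (1 - s) ^+ 2 / (1 - t * s)) / 2 by lra.
have -> : p = 2 - t by rewrite /t; ring.
(* The excess over 1 is exactly (1 - t)^2 s^2 / (1 - (t s)^2) with 1 - t = p - 1. The denominator is
   at most 1, and dropping it leaves the constant (p - 1)^2. *)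
have -> : ((1 + s) ^+ 2 / (1 + t * s) + (1 - s) ^+ 2 / (1 - t * s)) / 2
    = 1 + (1 - t) ^+ 2 * s ^+ 2 / (1 - (t * s) ^+ 2).
  by field; rewrite !gt_eqF.
rewrite (_ : 2 - t - 1 = 1 - t); last by ring.
rewrite addrC lerD2l ler_pdivlMr//.
by rewrite ler_piMr ?gerBl ?sqr_ge0// mulr_ge0 ?sqr_ge0.
Qed.

(** With h = (a + b)/2 and s = (a - b)/(a + b) one has a = h (1 + s) and b = h (1 - s), so
    everything scales by h^p and the symmetric inequality in s applies. The right-hand side is
    linear in the p-th powers of a, b and h, hence integrates term by term; e stays free because its
    best value is known only after integration. *)
Lemma powR_midpoint_gap {R : realType} (p a b e : R) : 1 < p -> 0 <= a -> 0 <= b ->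
  0 < e ->
  `|a - b| `^ p <= 2 `^ p * (e * ((a + b) / 2) `^ p
    + ((a `^ p + b `^ p) / 2 - ((a + b) / 2) `^ p)
      / (Num.min 1 ((p - 1) ^+ 2) * e)).
Proof.
move=> p1 a0 b0 e0; set c := Num.min _ _.
have p_neq0 : p != 0 by rewrite gt_eqF//; lra.
have c0 : 0 < c by rewrite lt_min ltr01 exprn_gt0// subr_gt0.
wlog ab : a b a0 b0 / b <= a.
  move=> h; have [|/ltW ba] := leP b a; first exact: h.
  by rewrite distrC [a + b]addrC [a `^ p + _]addrC; exact: h.
have [h0|hn0] := eqVneq (a + b) 0.
  have -> : a = 0 by lra.
  have -> : b = 0 by lra.
  by rewrite subr0 normr0 addr0 mul0r powR0// addr0 mul0r subr0 mulr0 mul0r addr0 mulr0.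
set h := (a + b) / 2; set s := (a - b) / (a + b).
have hp : 0 < h by rewrite divr_gt0// lt_def hn0 addr_ge0.
have abp : 0 < a + b by rewrite lt_def hn0 addr_ge0.
have s01 : 0 <= s <= 1.
  by apply/andP; split; rewrite /s ?divr_ge0 ?subr_ge0 ?addr_ge0// ler_pdivrMr//; lra.
have ea : a = h * (1 + s) by rewrite /h /s; field.
have eb : b = h * (1 - s) by rewrite /h /s; field.
have key := powR_symmetric_convex p1 s01.
rewrite -/c in key.
have [s0 s1] := andP s01.
have eab : `|a - b| = 2 * (h * s).
  by rewrite ger0_norm ?subr_ge0// /h /s; field.
have hpp : 0 < h `^ p by rewrite powR_gt0.
have h0 := ltW hp.
clearbody h s.
rewrite eab powRM// ?mulr_ge0// ler_wpM2l ?powR_ge0// powRM//.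
rewrite {1}ea {1}eb !powRM// ?subr_ge0// ?addr_ge0//.
have sps : s `^ p <= s.
  have [->|sn0] := eqVneq s 0; first by rewrite powR0.
  by apply: ge1r_powR; rewrite ?(ltW p1)// s1 lt_def sn0 s0.
(* The convexity deficit controls s^2 and not s. This weighted arithmetic-geometric inequality
   trades s for s^2 at the price of e. *)
have : s <= e + s ^+ 2 / e.
  rewrite -(ler_pM2r e0) mulrDl mulfVK ?gt_eqF//; nra.
move=> h2.
have : h `^ p * s `^ p <= h `^ p * (e + s ^+ 2 / e).
  by rewrite ler_wpM2l ?(ltW hpp)// (le_trans sps).
move=> /le_trans; apply.
set t := (1 + s) `^ p in key *; set r := (1 - s) `^ p in key *.
have -> : e * h `^ p + ((h `^ p * t + h `^ p * r) / 2 - h `^ p) / (c * e)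
    = h `^ p * (e + ((t + r) / 2 - 1) / c / e).
  by field; rewrite !gt_eqF.
rewrite ler_wpM2l ?(ltW hpp)// lerD2l ler_wpM2r ?invr_ge0 ?(ltW e0)//.
by rewrite ler_pdivlMr// mulrC; lra.
Qed.

(** * Integration by parts on R^N *)

Section derive_along.
Context {R : realType} {V1 V2 W : normedModType R}.
Variables (f : V2 -> W) (L : V1 -> V2) (x w : V1) (v : V2).
Hypothesis Lxw : forall h : R, L (h *: w + x) = h *: v + L x.

Let quotientE : (fun h : R => h^-1 *: (((f \o L) \o shift x) (h *: w) - (f \o L) x))
  = (fun h => h^-1 *: ((f \o shift (L x)) (h *: v) - f (L x))).
Proof. by apply/funext => h /=; rewrite Lxw. Qed.

(** Only the values of L on the line through x in direction w matter: the two difference quotients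
    are the same function of h. It identifies a partial derivative on R^(n+1), restricted to a
    slice, with a derivative of the slice. *)
Lemma derive_comp_affine : 'D_w (f \o L) x = 'D_v f (L x).
Proof. by rewrite /derive quotientE. Qed.

Lemma derivable_comp_affine : derivable f (L x) v -> derivable (f \o L) x w.
Proof. by rewrite /derivable quotientE. Qed.

End derive_along.

Section lebesgue_rV_integral.
Context {R : realType}.

(** A bound on the norm in place of compactness of the support: it passes at once to slices,
    products and derivatives. *)
Definition bounded_support {V : normedModType R} (W : zmodType) (g : V -> W) :=
  exists M : R, forall x, M < `|x| -> g x = 0.

Lemma cons_rV0 n (s : R) (y : 'rV[R]_n) : cons_rV (s, y) 0 ord0 = s.
Proof. by rewrite -[RHS](congr1 fst (uncons_rVK (s, y))). Qed.

Lemma cons_rVS n (s : R) (y : 'rV[R]_n) i : cons_rV (s, y) 0 (lift ord0 i) = y 0 i.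
Proof.
have -> : lift ord0 i = rshift 1 i by exact/val_inj.
by rewrite /cons_rV (@row_mxEr _ 1 1 n).
Qed.

Lemma cons_rV_affine0 n (s h : R) (y : 'rV[R]_n) :
  cons_rV (h *: 1 + s, y) = h *: delta_mx 0 ord0 + cons_rV (s, y).
Proof.
apply/rowP => i; rewrite [RHS]mxE [X in _ = X + _]mxE [delta_mx _ _ _ _]mxE.
have [j ->|->] := unliftP ord0 i; last first.
  by rewrite !cons_rV0 !eqxx /= mulr1 scaler1.
by rewrite !cons_rVS eq_sym (negbTE (neq_lift _ _)) andbF mulr0 add0r.
Qed.

Lemma cons_rV_affineS n (s h : R) (y : 'rV[R]_n) i :
  cons_rV (s, h *: delta_mx 0 i + y)
  = h *: delta_mx 0 (lift ord0 i) + cons_rV (s, y).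
Proof.
apply/rowP => k; rewrite [RHS]mxE [X in _ = X + _]mxE [delta_mx _ _ _ _]mxE.
have [j ->|->] := unliftP ord0 k.
  by rewrite !cons_rVS !mxE (inj_eq lift_inj).
by rewrite !cons_rV0 (negbTE (neq_lift _ _)) andbF mulr0 add0r.
Qed.

Lemma norm_coord_le n (x : 'rV[R]_n) i : `|x 0 i| <= `|x|.
Proof.
rewrite [leRHS]/Num.norm /= mx_normrE; apply/bigmax_geP; right => /=.
by exists (0, i).
Qed.

Lemma norm_cons_rV_ge1 n (s : R) (y : 'rV[R]_n) : `|s| <= `|cons_rV (s, y)|.
Proof. by rewrite -[in leLHS](cons_rV0 s y) norm_coord_le. Qed.

Lemma norm_cons_rV_ge2 n (s : R) (y : 'rV[R]_n) : `|y| <= `|cons_rV (s, y)|.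
Proof.
rewrite [leLHS]/Num.norm /= mx_normrE; apply: bigmax_le => // -[i j] _ /=.
by rewrite ord1 -(cons_rVS s) norm_coord_le.
Qed.

Lemma continuous_cons_rV1 n (y : 'rV[R]_n) : continuous (fun s : R => cons_rV (s, y)).
Proof.
move=> s A /= /nbhs_ballP[e /= e0 eA]; apply/nbhs_ballP; exists e => //= s' ss'.
apply: eA; split=> // i j; rewrite ord1.
by have [k ->|->] := unliftP ord0 j; rewrite ?cons_rV0 ?cons_rVS//; exact: ballxx.
Qed.

Lemma continuous_cons_rV2 n (s : R) : continuous (fun y : 'rV[R]_n => cons_rV (s, y)).
Proof.
move=> y A /= /nbhs_ballP[e /= e0 eA]; apply/nbhs_ballP; exists e => //= y' [_ yy'].
apply: eA; split=> // i j; rewrite ord1.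
by have [k ->|->] := unliftP ord0 j; rewrite ?cons_rV0 ?cons_rVS//; exact: ballxx.
Qed.

Lemma continuous_measurable_fun_rV n (g : 'rV[R]_n -> R) :
  continuous g -> measurable_fun setT g.
Proof.
move=> cg; apply: (measurability (@RGenOpens.G R)).
  exact: RGenOpens.measurableE.
move=> _ [B [x [y ->]] <-]; rewrite setTI; apply: open_measurable_mx.
by apply: open_comp; [move=> z _; exact: cg|exact: itv_open].
Qed.

Lemma continuous_bounded_support_bounded n (g : 'rV[R]_n -> R) :
  continuous g -> bounded_support g -> exists C, forall x, `|g x| <= C.
Proof.
move=> cg [M gM].
have /compact_bounded[C [_ HC]] : compact (g @` [set x | `|x| <= M]).
  apply: continuous_compact; first exact: continuous_subspaceT.
  apply: bounded_closed_compact.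
    by exists M; split; rewrite ?num_real// => M' MM' x /= xM; rewrite (le_trans xM)// ltW.
  apply: (@preimage_closed _ _ (fun x : 'rV[R]_n => `|x|) [set r | r <= M]) => [x _|].
    exact: norm_continuous.
  exact: closed_le.
exists (`|C| + 1) => x; have [xM|xM] := leP `|x| M.
  by apply: (HC (`|C| + 1)); [rewrite (le_lt_trans (ler_norm _))// ltrDl|exists x].
by rewrite gM// normr0 addr_ge0.
Qed.

Lemma lebesgue_rV_ball_lty n (M : R) :
  (lebesgue_rV n [set x : 'rV[R]_n | forall i, (x 0 i \in `[- M, M])%R] < +oo)%E.
Proof.
rewrite (lebesgue_rV_box (A := fun=> `[- M, M]%classic))//.
rewrite (eq_bigr (fun=> (fine (lebesgue_measure `[- M, M]%classic))%:E)).
  by rewrite prodEFin ltry.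
by move=> i _; rewrite fineK// lebesgue_measure_itv; case: ifP.
Qed.

Lemma bounded_support_integrable n (g : 'rV[R]_n -> R) :
  measurable_fun setT g -> (exists C, forall x, `|g x| <= C) -> bounded_support g ->
  (lebesgue_rV n).-integrable setT (EFin \o g).
Proof.
move=> mg [C gC] [M gM].
set B := [set x : 'rV[R]_n | forall i, x 0 i \in `[- M, M]].
have mB : measurable B.
  rewrite [X in _ X](_ : _ = \bigcap_i [set x : 'rV[R]_n | x 0 i \in `[- M, M]]).
    apply: fin_bigcap_measurable => // i _; rewrite -[X in measurable X]setTI.
    exact: (@coord_measurable_mx R 1 n 0 i measurableT _ (measurable_itv `[- M, M])).
  by apply/seteqP; split => x /= Ax i; [move=> _|]; exact: Ax.
have iB : (lebesgue_rV n).-integrable B (EFin \o g).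
  apply: measurable_bounded_integrable => //.
  - exact: lebesgue_rV_ball_lty.
  - exact: measurable_funTS.
  - exists C; split; rewrite ?num_real// => C' CC' x _.
    by rewrite /= (le_trans (gC x))// ltW.
move/(integrable_mkcond _ mB) : iB; congr (_.-integrable _ _).
apply/funext => x; rewrite patchE; case: ifPn => //= /negP xB.
rewrite gM// ltNge; apply/negP => xM; apply: xB; rewrite inE => i /=.
by rewrite in_itv/= -ler_norml (le_trans (norm_coord_le _ _)).
Qed.

Lemma continuous_bounded_support_integrable n (g : 'rV[R]_n -> R) :
  continuous g -> bounded_support g ->
  (lebesgue_rV n).-integrable setT (EFin \o g).
Proof.
move=> cg bg; apply: bounded_support_integrable => //.
  exact: continuous_measurable_fun_rV.
exact: continuous_bounded_support_bounded.
Qed.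

(** The measure on R^(n+1) is by construction the image of a product under [cons_rV]. Both orders of
    integration are recorded because the differentiated coordinate has to be among the inner
    variables. *)
Lemma lebesgue_rVS_fubini n (g : 'rV[R]_n.+1 -> \bar R) :
  (lebesgue_rV n.+1).-integrable setT g ->
  (\int[lebesgue_rV n.+1]_x g x
   = \int[lebesgue_measure]_s \int[lebesgue_rV n]_y g (cons_rV (s, y)))%E /\
  (\int[lebesgue_rV n.+1]_x g x
   = \int[lebesgue_rV n]_y \int[lebesgue_measure]_s g (cons_rV (s, y)))%E.
Proof.
move=> ig; have /integrableP[mg ig_lty] := ig.
have mc : measurable_fun [set: (measurableTypeR R * 'rV[R]_n)%type] (@cons_rV R n).
  exact: measurable_cons_rV.
have iP : (@lebesgue_measure R \x lebesgue_rV n)%E.-integrable setT (g \o @cons_rV R n).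
  apply/integrableP; split.
    by apply: measurableT_comp => //; exact: measurable_cons_rV.
  apply: le_lt_trans ig_lty; rewrite le_eqVlt; apply/orP; left; apply/eqP/esym.
  have := @ge0_integral_pushforward _ _ _ _ _ _ mc
    (@lebesgue_measure R \x lebesgue_rV n)%E setT (abse \o g) measurableT.
  rewrite preimage_setT; apply => //; first exact: measurableT_comp.
  by move=> y _; exact: abse_ge0.
have -> : (\int[lebesgue_rV n.+1]_x g x
    = \int[@lebesgue_measure R \x lebesgue_rV n]_z (g \o @cons_rV R n) z)%E.
  have := @integral_pushforward _ _ _ _ _ _ mc
    (@lebesgue_measure R \x lebesgue_rV n)%E setT g mg.
  by rewrite preimage_setT; apply.
by split; [rewrite -(integral12_prod_meas1 iP)|rewrite -(integral21_prod_meas1 iP)].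
Qed.

End lebesgue_rV_integral.

Section integral_partial.
Context {R : realType}.

Lemma derive_bounded_support (V : normedModType R) (g : V -> R) (v : V) :
  bounded_support g -> bounded_support (fun x => 'D_v g x).
Proof.
move=> [M gM]; exists M => x Mx.
rewrite (@near_eq_derive _ _ _ _ (cst 0)) ?derive_cst//.
have : nbhs x [set y | M < `|y|].
  have /open_nbhs_nbhs := conj (@open_gt R M) Mx.
  exact: (@norm_continuous _ V x).
by apply: filterS => y /= /gM.
Qed.

Lemma integral_derive1_bounded_support (g : R -> R) :
  (forall s, derivable g s 1) -> continuous (fun s => 'D_1 g s) ->
  bounded_support g ->
  (\int[lebesgue_measure]_s ('D_1 g s)%:E = 0)%E.
Proof.
move=> dg cg bg; have [M gM] := bg.
have cont_g : continuous g.
  by move=> s; apply/differentiable_continuous/derivable1_diffP.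
have [M' g'M] := @derive_bounded_support _ g 1 bg.
(* K exceeds both M and M', so g vanishes at the endpoints and its derivative vanishes outside the
   interval. *)
set K : R := `|M| + `|M'| + 1.
have K0 : 0 < K by rewrite ltr_wpDl// addr_ge0.
have MK : M < K.
  by rewrite /K ltr_pwDr// (le_trans (ler_norm M))// lerDl.
have M'K : M' < K.
  by rewrite /K ltr_pwDr// (le_trans (ler_norm M'))// lerDr.
have -> : (\int[lebesgue_measure]_s ('D_1 g s)%:E
    = \int[lebesgue_measure]_(s in `[(- K)%R, K]) ('D_1 g s)%:E)%E.
  rewrite [RHS]integral_mkcond; apply: eq_integral => s _; rewrite patchE.
  case: ifPn => // /negP sK; rewrite g'M// (lt_trans M'K)// ltNge; apply/negP => sK'.
  by apply: sK; rewrite inE/= in_itv/= -ler_norml.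
rewrite (@continuous_FTC2 _ _ g).
- by rewrite !gM ?subee// ?normrN gtr0_norm.
- by rewrite gtrN.
- exact: continuous_subspaceT.
- split; first by move=> s _; exact: dg.
  + exact/cvg_at_right_filter/cont_g.
  + exact/cvg_at_left_filter/cont_g.
- by move=> s _; rewrite derive1E.
Qed.

(** Induction on the dimension. If i is the first coordinate, the inner integral over R vanishes by
    the fundamental theorem of calculus; otherwise the slices with fixed first coordinate satisfy
    the same hypotheses one dimension lower. *)
Lemma integral_partial_eq0 N (i : 'I_N) (F : 'rV[R]_N -> R) :
  (forall x, derivable F x (delta_mx 0 i)) -> continuous (partial i F) ->
  bounded_support F ->
  (\int[lebesgue_rV N]_x (partial i F x)%:E = 0)%E.
Proof.
elim: N i F => [[]//|n IH] i F dF cF bF; have [M FM] := bF.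
have iF := continuous_bounded_support_integrable cF (derive_bounded_support _ bF).
have [E1 E2] := lebesgue_rVS_fubini iF.
have [j ij|i0] := unliftP ord0 i.
- rewrite E1 integral0_eq// => s _.
  have ES y : partial i F (cons_rV (s, y)) = partial j (F \o (fun y => cons_rV (s, y))) y.
    rewrite /partial ij; apply/esym/derive_comp_affine => h.
    by rewrite cons_rV_affineS.
  under eq_integral do rewrite /= ES.
  apply: IH.
  + move=> y; apply: (@derivable_comp_affine _ _ _ _ _ _ _ _ (delta_mx 0 (lift ord0 j))).
      by move=> h; rewrite cons_rV_affineS.
    by rewrite -ij; exact: dF.
  + rewrite (_ : partial _ _ = partial i F \o (fun y => cons_rV (s, y))).
      by move=> y; apply: continuous_comp; [exact: continuous_cons_rV2|exact: cF].
    by apply/funext => y /=; rewrite ES.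
  + exists M => y My /=; apply: FM.
    by rewrite (lt_le_trans My)// norm_cons_rV_ge2.
- rewrite E2 integral0_eq// => y _.
  have ES s : partial i F (cons_rV (s, y)) = 'D_1 (F \o (fun s => cons_rV (s, y))) s.
    rewrite /partial i0; apply/esym/derive_comp_affine => h.
    by rewrite cons_rV_affine0.
  under eq_integral do rewrite /= ES.
  apply: integral_derive1_bounded_support.
  + move=> s; apply: (@derivable_comp_affine _ _ _ _ _ _ _ _ (delta_mx 0 ord0)).
      by move=> h; rewrite cons_rV_affine0.
    by rewrite -i0; exact: dF.
  + rewrite (_ : (fun s => _) = partial i F \o (fun s => cons_rV (s, y))).
      by move=> s; apply: continuous_comp; [exact: continuous_cons_rV1|exact: cF].
    by apply/funext => s /=; rewrite ES.
  + exists M => s Ms /=; apply: FM.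
    by rewrite (lt_le_trans Ms)// norm_cons_rV_ge1.
Qed.

Lemma integration_by_parts_rV N (i : 'I_N) (u v : 'rV[R]_N -> R) :
  (forall x, derivable u x (delta_mx 0 i)) ->
  (forall x, derivable v x (delta_mx 0 i)) ->
  continuous u -> continuous v ->
  continuous (partial i u) -> continuous (partial i v) ->
  bounded_support u ->
  (\int[lebesgue_rV N]_x (partial i u x * v x)%:E
   = - \int[lebesgue_rV N]_x (u x * partial i v x)%:E)%E.
Proof.
move=> du dv cu cv cdu cdv bu; have [M uM] := bu.
have [M' duM] := derive_bounded_support (delta_mx 0 i) bu.
have E x : partial i (u * v) x = u x * partial i v x + partial i u x * v x.
  by rewrite /partial deriveM//= [v x *: _]mulrC.
have c1 : continuous (fun x => u x * partial i v x).
  by move=> x; apply: continuousM; [exact: cu|exact: cdv].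
have c2 : continuous (fun x => partial i u x * v x).
  by move=> x; apply: continuousM; [exact: cdu|exact: cv].
have i1 : (lebesgue_rV N).-integrable setT (fun x => (u x * partial i v x)%:E).
  apply: continuous_bounded_support_integrable => //.
  by exists M => x /uM ->; rewrite mul0r.
have i2 : (lebesgue_rV N).-integrable setT (fun x => (partial i u x * v x)%:E).
  apply: continuous_bounded_support_integrable => //.
  by exists M' => x /duM; rewrite -/(partial i u x) => ->; rewrite mul0r.
have := @integral_partial_eq0 N i (u * v).
have -> : partial i (u * v) = (fun x => u x * partial i v x + partial i u x * v x).
  exact/funext.
move=> /(_ _ _ _)/=.
under eq_integral do rewrite EFinD.
rewrite integralD//= => H.
have {}H : (\int[lebesgue_rV N]_x (u x * partial i v x)%:E
    + \int[lebesgue_rV N]_x (partial i u x * v x)%:E = 0)%E.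
  apply: H.
  - by move=> x; apply: derivableM.
  - by move=> x; exact: (continuousD (c1 x) (c2 x)).
  - by exists M => x /uM; rewrite /GRing.mul/= => ->; rewrite mul0r.
move: H; have /fineK <- := integrable_fin_num measurableT i1.
have /fineK <- := integrable_fin_num measurableT i2.
by rewrite -EFinD => -[H]; congr EFin; apply/eqP; rewrite -addr_eq0 addrC H.
Qed.

End integral_partial.

(** * Test functions and weak gradients *)

Section test_functions.
Context {R : realType} {N : nat}.
Local Notation E := 'rV[R]_N.
Local Notation mu := (lebesgue_rV N).
Implicit Types (Omega : set E) (u phi psi : E -> R).

Lemma test_function_derivable Omega phi x i :
  test_function Omega phi -> derivable phi x (delta_mx 0 i).
Proof. by move=> [/(_ [::])[_ /(_ i x)]]. Qed.

Lemma test_function_continuous Omega phi : test_function Omega phi -> continuous phi.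
Proof. by move=> [/(_ [::])[]]. Qed.

Lemma test_function_partial Omega phi i :
  test_function Omega phi -> test_function Omega (partial i phi).
Proof.
move=> [sphi cphi sub].
have sub1 : Defs.support (partial i phi) `<=` Defs.support phi.
  rewrite [X in _ `<=` X](_ : _ = closure (Defs.support phi)); last first.
    by apply/closure_id; exact: closed_closure.
  apply: closureS => x /= dx; apply: contrapT => xphi; move/negP: dx; apply.
  rewrite /partial (@near_eq_derive _ _ _ _ (cst 0)) ?derive_cst//.
  have : nbhs x (~` Defs.support phi).
    by apply: open_nbhs_nbhs; split => //; apply: closed_openC; exact: closed_closure.
  apply: filterS => y yphi; apply: contrapT => /eqP y0.
  by apply: yphi; apply: subset_closure.
split.
- move=> s; have := sphi (rcons s i); rewrite /iter_partial foldr_rcons.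
  by move=> [? ?]; split.
- by apply: subclosed_compact cphi sub1; exact: closed_closure.
- exact: subset_trans sub.
Qed.

Lemma test_function_bounded_support Omega phi :
  test_function Omega phi -> bounded_support phi.
Proof.
move=> [_ /compact_bounded[M [_ HM]] _]; exists (`|M| + 1) => x Mx.
apply: contrapT => /eqP x0.
have : `|x| <= `|M| + 1.
  apply: (HM (`|M| + 1)); first by rewrite (le_lt_trans (ler_norm _))// ltrDl.
  exact: subset_closure.
by rewrite leNgt Mx.
Qed.

Lemma test_function_eq0 Omega phi x : test_function Omega phi -> ~ Omega x -> phi x = 0.
Proof.
move=> [_ _ sub] Ox; apply: contrapT => /eqP x0; apply: Ox; apply: sub.
exact: subset_closure.
Qed.

Lemma test_function0 Omega : test_function Omega (fun=> 0 : R).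
Proof.
have E0 s : iter_partial s (fun=> 0 : R) = (fun=> 0) :> (E -> R).
  elim: s => //= i s ->; apply/funext => x.
  by rewrite /partial (_ : (fun=> 0) = cst 0)// derive_cst.
have S0 : Defs.support (fun=> 0 : R) = set0 :> set E.
  rewrite /Defs.support (_ : [set _ | _] = set0) ?closure0//.
  by apply/seteqP; split => // x /=; rewrite eqxx.
split.
- by move=> s; rewrite E0; split => [x|i x]; [exact: cst_continuous|exact: derivable_cst].
- by rewrite S0; exact: compact0.
- by rewrite S0.
Qed.

Lemma partial_linear i (a : R) phi psi x :
  derivable phi x (delta_mx 0 i) -> derivable psi x (delta_mx 0 i) ->
  partial i (fun x => a * phi x + psi x) x = a * partial i phi x + partial i psi x.
Proof.
move=> dphi dpsi; rewrite /partial.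
rewrite (_ : (fun x => _) = (a \*: phi) + psi); last exact/funext.
by rewrite deriveD//; [rewrite deriveZ|exact: derivableZ].
Qed.

Lemma test_function_linear Omega (a : R) phi psi :
  test_function Omega phi -> test_function Omega psi ->
  test_function Omega (fun x => a * phi x + psi x).
Proof.
move=> [sphi cphi subphi] [spsi cpsi subpsi].
have sub : Defs.support (fun x => a * phi x + psi x) `<=` Defs.support phi `|` Defs.support psi.
  rewrite /Defs.support -closureU; apply: closureS => x /= nz; apply: contrapT.
  move=> /not_orP[/negP/negPn/eqP p1 /negP/negPn/eqP p2].
  by move: nz; rewrite p1 p2 mulr0 addr0 eqxx.
have E1 s : iter_partial s (fun x => a * phi x + psi x)
    = (fun x => a * iter_partial s phi x + iter_partial s psi x).
  elim: s => //= i s IH; rewrite IH; apply/funext => x.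
  by rewrite partial_linear//; [exact: (sphi s).2|exact: (spsi s).2].
split.
- move=> s; rewrite E1; split=> [x|i x].
    apply: (@continuousD _ _ _ (fun x => a * iter_partial s phi x)).
      by apply: continuousM; [exact: cst_continuous|exact: (sphi s).1].
    exact: (spsi s).1.
  rewrite (_ : (fun x => _) = (a \*: iter_partial s phi) + iter_partial s psi); last exact/funext.
  by apply: derivableD; [apply: derivableZ; exact: (sphi s).2|exact: (spsi s).2].
- apply: subclosed_compact (compactU cphi cpsi) sub; exact: closed_closure.
- by move=> x /sub [/subphi|/subpsi].
Qed.

Lemma gradient_linear Omega (a : R) phi psi x :
  test_function Omega phi -> test_function Omega psi ->
  gradient (fun x => a * phi x + psi x) x = a *: gradient phi x + gradient psi x.
Proof.
move=> tphi tpsi; apply/rowP => i; rewrite !mxE.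
by rewrite partial_linear//; [exact: test_function_derivable tphi|
  exact: test_function_derivable tpsi].
Qed.

(** The Borel sigma-algebra on row vectors is generated by the open sets and not defined as a
    product, so measurability is assembled one coordinate at a time through [cons_rV]. A general D
    is reduced to the whole space by extending the coordinates by 0. *)
Lemma measurable_fun_rV d (T : measurableType d) n (D : set T) (G : T -> 'rV[R]_n) :
  (forall i, measurable_fun D (fun x => G x 0 i)) -> measurable_fun D G.
Proof.
have mT m (F : T -> 'rV[R]_m) :
    (forall i, measurable_fun setT (fun x => F x 0 i)) -> measurable_fun setT F.
  elim: m F => [|m IH] F mF.
    rewrite (_ : F = cst 0); last by apply/funext => x; apply/rowP => -[].
    exact: measurable_cst.
  have -> : F = @cons_rV R m \o (fun x => (F x 0 ord0, \row_j F x 0 (lift ord0 j))).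
    apply/funext => x; apply/rowP => i /=.
    by have [j ->|->] := unliftP ord0 i; rewrite ?cons_rV0// cons_rVS mxE.
  apply: measurableT_comp; first exact: measurable_cons_rV.
  apply: measurable_fun_pair; first exact: mF.
  apply: IH => i; apply: eq_measurable_fun (mF (lift ord0 i)) => x _.
  by rewrite mxE.
move=> mG mD; suff : measurable_fun D G by apply.
apply: (eq_measurable_fun (fun x => \row_i ((fun x => G x 0 i) \_ D) x)).
  by move=> x xD; apply/rowP => i; rewrite mxE patchE xD.
apply: measurable_funTS; apply: mT => i.
apply: eq_measurable_fun ((measurable_restrictT _ mD).1 (mG i)) => x _.
by rewrite mxE.
Qed.

Lemma measurable_fun_coord d (T : measurableType d) n (D : set T) (G : T -> 'rV[R]_n) i :
  measurable_fun D G -> measurable_fun D (fun x => G x 0 i).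
Proof. by move=> mG; apply: (measurableT_comp (@coord_measurable_mx R 1 n 0 i)). Qed.

Lemma measurable_sqnorm d (T : measurableType d) (D : set T) (G : T -> E) :
  measurable_fun D G -> measurable_fun D (fun x => sqnorm (G x)).
Proof.
move=> mG; apply: measurable_sum => i.
by apply: measurable_funX; exact: measurable_fun_coord.
Qed.

Lemma measurable_rV_linear d (T : measurableType d) (D : set T) (a : R) (G H : T -> E) :
  measurable_fun D G -> measurable_fun D H -> measurable_fun D (fun x => a *: G x + H x).
Proof.
move=> mG mH; apply: measurable_fun_rV => i.
apply: (eq_measurable_fun (fun x => a * G x 0 i + H x 0 i)).
  by move=> x _; rewrite !mxE.
by apply: measurable_funD; [apply: measurable_funM => //|]; exact: measurable_fun_coord.
Qed.

Lemma sqnorm_ge0 (v : E) : 0 <= sqnorm v.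
Proof. by apply: sumr_ge0 => i _; exact: sqr_ge0. Qed.

Lemma measurable_gradient Omega phi :
  test_function Omega phi -> measurable_fun setT (gradient phi).
Proof.
move=> tphi; apply: measurable_fun_rV => i.
apply: (eq_measurable_fun (partial i phi)) => [x _|]; first by rewrite mxE.
apply: continuous_measurable_fun_rV; apply: test_function_continuous.
exact: test_function_partial tphi.
Qed.

End test_functions.

(** * Closability of the gradient *)

Section weak_gradient.
Context {R : realType} {N : nat}.
Local Notation E := 'rV[R]_N.
Local Notation mu := (lebesgue_rV N).
Implicit Types (Omega : set E) (u v phi psi : E -> R) (G H : E -> E).

Lemma cvge0_near_lt (s : nat -> \bar R) (e : R) : 0 < e ->
  s @ \oo --> 0%E -> \forall n \near \oo, (s n < e%:E)%E.
Proof.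
move=> e0 cs; apply: (cs [set y | (y < e%:E)%E]).
exact: (@nbhs_open_ereal_lt _ 0 (fun=> e)).
Qed.

Lemma Lp_norm_test_function Omega (r : R) phi : test_function Omega phi ->
  Lp_norm Omega r (fun x => (phi x)%:E) = ('N[mu]_r%:E[EFin \o phi])%E.
Proof.
move=> tphi; rewrite /Lp_norm; apply: eq_Lnorm => x; rewrite patchE /=.
by case: ifPn => // /negP xO; rewrite (test_function_eq0 tphi)// => xO'; apply: xO; rewrite inE.
Qed.

Lemma powR_bounded_support_integrable n (g : 'rV[R]_n -> R) (r : R) : 0 < r ->
  continuous g -> bounded_support g ->
  (lebesgue_rV n).-integrable setT (fun x => (`|g x| `^ r)%:E).
Proof.
move=> r0 cg bg; have [C gC] := continuous_bounded_support_bounded cg bg.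
apply: (@bounded_support_integrable _ _ (fun x => `|g x| `^ r)).
- apply: (measurableT_comp (measurable_powR r)); apply: measurableT_comp => //.
  exact: continuous_measurable_fun_rV.
- exists (`|C| `^ r) => x; rewrite ger0_norm ?powR_ge0// ge0_ler_powR ?nnegrE ?(ltW r0)//.
  by rewrite (le_trans (gC x))// ler_norm.
- by case: bg => M gM; exists M => x /gM ->; rewrite normr0 powR0 ?gt_eqF.
Qed.

Lemma Lnorm_bounded_support_lty n (g : 'rV[R]_n -> R) (r : R) : 0 < r ->
  continuous g -> bounded_support g ->
  ('N[lebesgue_rV n]_r%:E[EFin \o g] < +oo)%E.
Proof.
move=> r0 cg bg; rewrite unlock /=; apply: poweR_lty.
exact: (integrable_lty measurableT (powR_bounded_support_integrable r0 cg bg)).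
Qed.

Lemma crit_exp_gt0 : (3 <= N)%N -> 0 < @crit_exp R N.
Proof.
move=> hN; have N3 : 3 <= N%:R :> R by rewrite (ler_nat _ 3).
by rewrite divr_gt0//; lra.
Qed.

Lemma crit_exp_conj_gt0 : (3 <= N)%N -> 0 < @crit_exp_conj R N.
Proof.
move=> hN; have N3 : 3 <= N%:R :> R by rewrite (ler_nat _ 3).
by rewrite divr_gt0//; lra.
Qed.

Lemma crit_exp_conjugate : (3 <= N)%N ->
  (@crit_exp R N)^-1 + (@crit_exp_conj R N)^-1 = 1.
Proof.
move=> hN; have N3 : 3 <= N%:R :> R by rewrite (ler_nat _ 3).
by rewrite /crit_exp /crit_exp_conj; field; rewrite !gt_eqF//=; lra.
Qed.

Definition dotmul (v w : E) : R := \sum_i v 0 i * w 0 i.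

Lemma integrable_dot_gradient Omega phi psi : measurable Omega ->
  test_function Omega phi -> test_function Omega psi ->
  mu.-integrable Omega (fun x => (dotmul (gradient phi x) (gradient psi x))%:E).
Proof.
move=> mO tphi tpsi; apply: (integrableS measurableT) => //.
apply: (eq_integrable measurableT
  (fun x => \sum_i (partial i phi x * partial i psi x)%:E)%E).
  move=> x _; rewrite /dotmul sumEFin.
  by congr EFin; apply: eq_bigr => i _; rewrite !mxE.
apply: integrable_sum => // i _; apply: continuous_bounded_support_integrable.
  move=> x; apply: continuousM.
    exact: (test_function_continuous (test_function_partial i tphi)).
  exact: (test_function_continuous (test_function_partial i tpsi)).
have [M HM] := test_function_bounded_support (test_function_partial i tphi).
by exists M => x /HM ->; rewrite mul0r.
Qed.

(** Integration by parts moves the derivatives off phi, and Hoelder pairs phi with the second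
    derivatives of psi in the exponents 2N/(N-2) and 2N/(N+2). K is found before phi: it depends on
    psi alone. *)
Lemma integral_dot_gradient_le Omega psi : (3 <= N)%N -> measurable Omega ->
  test_function Omega psi ->
  exists K : R, 0 <= K /\ forall phi, test_function Omega phi ->
    (\int[mu]_(x in Omega) (dotmul (gradient phi x) (gradient psi x))%:E
     <= Lp_norm Omega (@crit_exp R N) (fun x => (phi x)%:E) * K%:E)%E.
Proof.
move=> hN mO tpsi.
have t1 i := test_function_partial i tpsi.
have t2 i := test_function_partial i (t1 i).
set r := @crit_exp_conj R N.
pose K i := ('N[mu]_r%:E[EFin \o partial i (partial i psi)])%E.
have Kfin i : K i \is a fin_num.
  rewrite ge0_fin_numE ?Lnorm_ge0//; apply: Lnorm_bounded_support_lty.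
  - exact: crit_exp_conj_gt0.
  - exact: test_function_continuous (t2 i).
  - exact: test_function_bounded_support (t2 i).
exists (\sum_i fine (K i)); split.
  by apply: sumr_ge0 => i _; rewrite fine_ge0// Lnorm_ge0.
move=> phi tphi; rewrite (Lp_norm_test_function _ tphi).
have s1 i := test_function_partial i tphi.
have -> : (\int[mu]_(x in Omega) (dotmul (gradient phi x) (gradient psi x))%:E
    = \int[mu]_x \sum_i (partial i phi x * partial i psi x)%:E)%E.
  rewrite integral_mkcond; apply: eq_integral => x _; rewrite patchE.
  case: ifPn => [_|/negP xO].
    rewrite sumEFin; congr EFin; apply: eq_bigr => i _; rewrite !mxE//.
  rewrite big1// => i _; rewrite (test_function_eq0 (s1 i)) ?mul0r//.
  by move=> xO'; apply: xO; rewrite inE.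
have cM (g h : E -> R) : continuous g -> continuous h -> bounded_support g ->
    mu.-integrable setT (fun x => (g x * h x)%:E).
  move=> cg ch [M HM]; apply: continuous_bounded_support_integrable.
    by move=> x; apply: continuousM; [exact: cg|exact: ch].
  by exists M => x /HM ->; rewrite mul0r.
rewrite integral_sum//; last first.
  move=> i; apply: cM.
  - exact: test_function_continuous (s1 i).
  - exact: test_function_continuous (t1 i).
  - exact: test_function_bounded_support (s1 i).
rewrite -sumEFin ge0_sume_distrr; last by move=> i _; rewrite lee_fin fine_ge0// Lnorm_ge0.
apply: lee_sum => i _; rewrite fineK//.
rewrite integration_by_parts_rV; last first.
- exact: test_function_bounded_support tphi.
- exact: test_function_continuous (t2 i).
- exact: test_function_continuous (s1 i).
- exact: test_function_continuous (t1 i).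
- exact: test_function_continuous tphi.
- by move=> x; exact: test_function_derivable (t1 i).
- by move=> x; exact: test_function_derivable tphi.
apply: le_trans (lee_abs _) _; rewrite abseN.
apply: le_trans (le_abse_integral _ measurableT _) _.
  apply/measurable_EFinP; apply: measurable_funM; apply: continuous_measurable_fun_rV.
    exact: test_function_continuous tphi.
  exact: test_function_continuous (t2 i).
rewrite -Lnorm1; apply: hoelder.
- by apply: continuous_measurable_fun_rV; exact: test_function_continuous tphi.
- by apply: continuous_measurable_fun_rV; exact: test_function_continuous (t2 i).
- exact: crit_exp_gt0.
- exact: crit_exp_conj_gt0.
- exact: crit_exp_conjugate.
Qed.

(** If a and b are both close to h, then their dot product is close to the square of h; the weights
    4 and 6 are large enough to absorb the cross terms. It makes H small once two gradients near H
    have a small dot product. *)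
Lemma sqnorm_le_dot (a b h : E) :
  sqnorm h <= 4 * sqnorm (a - h) + 6 * sqnorm (b - h) + 4 * dotmul a b.
Proof.
rewrite /sqnorm /dotmul !mulr_sumr -!big_split /=; apply: ler_sum => i _.
rewrite !mxE; set x := a 0 i; set y := b 0 i; set z := h 0 i.
have := sqr_ge0 (z + 2 * (x - z + (y - z)) / 3); have := sqr_ge0 (x - z + (y - z)).
by have := sqr_ge0 (x - z); have := sqr_ge0 (y - z); nra.
Qed.

Lemma gradient_closable Omega H : (3 <= N)%N -> measurable Omega ->
  sobolev0_gradient Omega (fun=> 0) H ->
  (\int[mu]_(x in Omega) (sqnorm (H x))%:E = 0)%E.
Proof.
move=> hN mO [_ mH [chi [tchi chi0 cG]]].
apply/eqP; rewrite eq_le integral_ge0 ?andbT; last first.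
  by move=> x _; rewrite lee_fin sqnorm_ge0.
apply/lee_addgt0Pr => e e0; rewrite add0e.
set S := (fun n => _) in cG.
have cL : (fun n => Lp_norm Omega (@crit_exp R N) (fun x => (chi n x)%:E)) @ \oo --> 0%E.
  by move: chi0; under eq_fun do under eq_fun do rewrite subr0.
have e20 : 0 < e / 20 by rewrite divr_gt0.
(* The order matters: m is fixed first, because the constant K that n has to beat depends on
   chi_m. *)
have [m _ Sm] := cvge0_near_lt e20 cG.
have [K [K0 HK]] := integral_dot_gradient_le hN mO (tchi m).
have eK : 0 < e / (20 * (K + 1)) by rewrite divr_gt0// mulr_gt0// ltr_wpDl.
have [n [Sn Ln]] : exists n, (S n < (e / 20)%:E)%E /\
    (Lp_norm Omega (@crit_exp R N) (fun x => (chi n x)%:E) < (e / (20 * (K + 1)))%:E)%E.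
  have [n1 _ H1] := cvge0_near_lt e20 cG; have [n2 _ H2] := cvge0_near_lt eK cL.
  exists (maxn n1 n2); split; [apply: H1|apply: H2]; rewrite /= ?leq_maxl ?leq_maxr//.
have {}Sm := Sm m (leqnn m).
have mS k : measurable_fun Omega (fun x => sqnorm (gradient (chi k) x - H x)).
  apply: measurable_sqnorm.
  apply: (eq_measurable_fun (fun x => (-1) *: H x + gradient (chi k) x)).
    by move=> x _; rewrite scaleN1r addrC.
  apply: measurable_rV_linear => //; apply: measurable_funTS.
  exact: measurable_gradient (tchi k).
have iS k : (S k < (e / 20)%:E)%E ->
    mu.-integrable Omega (fun x => (sqnorm (gradient (chi k) x - H x))%:E).
  move=> Sk; apply/integrableP; split; first exact/measurable_EFinP.
  under eq_integral do rewrite gee0_abs ?lee_fin ?sqnorm_ge0//.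
  by rewrite (lt_trans Sk)// ltry.
have iD := integrable_dot_gradient mO (tchi n) (tchi m).
have D_le : (\int[mu]_(x in Omega) (dotmul (gradient (chi n) x) (gradient (chi m) x))%:E
    <= (e / 20)%:E)%E.
  apply: le_trans (HK _ (tchi n)) _.
  apply: (@le_trans _ _ ((e / (20 * (K + 1)))%:E * K%:E)%E).
    by apply: lee_wpmul2r; [rewrite lee_fin|exact: ltW].
  rewrite -EFinM lee_fin.
  rewrite (_ : e / (20 * (K + 1)) * K = e / 20 * (K / (K + 1))).
    by rewrite ler_piMr// ?(ltW e20)// ler_pdivrMr; lra.
  by field; rewrite gt_eqF//; lra.
pose r x : R := 4 * sqnorm (gradient (chi n) x - H x)
  + 6 * sqnorm (gradient (chi m) x - H x)
  + 4 * dotmul (gradient (chi n) x) (gradient (chi m) x).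
apply: (@le_trans _ _ (\int[mu]_(x in Omega) (r x)%:E)%E).
  apply: ge0_le_integral => //.
  - by move=> x _; rewrite lee_fin sqnorm_ge0.
  - by apply/measurable_EFinP; exact: measurable_sqnorm.
  - apply/measurable_EFinP; apply: measurable_funD.
      by apply: measurable_funD; apply: measurable_funM => //.
    apply: measurable_funM => //.
    by have /integrableP[/measurable_EFinP] := iD.
  - by move=> x _; rewrite lee_fin sqnorm_le_dot.
have -> : (\int[mu]_(x in Omega) (r x)%:E = 4%:E * S n + 6%:E * S m
    + 4%:E * \int[mu]_(x in Omega) (dotmul (gradient (chi n) x) (gradient (chi m) x))%:E)%E.
  have i1 := integrableZl mO 4 (iS n Sn).
  have i2 := integrableZl mO 6 (iS m Sm).
  have i3 := integrableZl mO 4 iD.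
  under eq_integral do rewrite /r !EFinD !EFinM.
  rewrite (integralD mO (integrableD mO i1 i2) i3) (integralD mO i1 i2).
  by rewrite (integralZl mO (iS n Sn)) (integralZl mO (iS m Sm)) (integralZl mO iD).
have cM (c : R) (x y : \bar R) : 0 <= c -> (x <= y -> c%:E * x <= c%:E * y)%E.
  by move=> c0 xy; apply: lee_wpmul2l; rewrite ?lee_fin.
(* The three terms take 4 + 6 + 4 of the twenty parts of e; the last six are slack. *)
have -> : e = 4 * (e / 20) + 6 * (e / 20) + 4 * (e / 20) + 6 * (e / 20) by lra.
apply: le_trans (leeD (leeD (cM 4 _ _ _ (ltW Sn)) (cM 6 _ _ _ (ltW Sm))) (cM 4 _ _ _ D_le)) _.
- by [].
- by [].
- by [].
set t := e / 20; rewrite !EFinD !EFinM leeDl// -EFinM lee_fin.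
by apply: mulr_ge0; [exact: ler0n|exact: ltW].
Qed.

End weak_gradient.

(** * Linear structure of the Sobolev space and convexity of the Dirichlet integral *)

Section sobolev_space.
Context {R : realType} {N : nat}.
Local Notation E := 'rV[R]_N.
Local Notation mu := (lebesgue_rV N).
Implicit Types (Omega : set E) (u v phi psi : E -> R) (G H : E -> E).

Lemma Lnorm_scale (g : E -> R) (a r : R) : 0 < r -> measurable_fun setT g ->
  ('N[mu]_r%:E[EFin \o (fun x => (a * g x)%R)] = `|a|%:E * 'N[mu]_r%:E[EFin \o g])%E.
Proof.
move=> r0 mg; rewrite unlock /=.
under eq_integral do rewrite normrM powRM// EFinM.
rewrite ge0_integralZl_EFin ?powR_ge0//; last first.
  by apply/measurable_EFinP/(measurableT_comp (measurable_powR r))/measurableT_comp.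
rewrite poweRM ?lee_fin ?powR_ge0//; last by apply: integral_ge0 => x _; rewrite lee_fin powR_ge0.
by rewrite poweR_EFin -powRrM divff ?gt_eqF// powRr1.
Qed.

Lemma Lp_norm_EFin Omega (r : R) (g : E -> R) :
  Lp_norm Omega r (fun x => (g x)%:E) = ('N[mu]_r%:E[EFin \o (g \_ Omega)])%E.
Proof. by rewrite /Lp_norm -restrict_EFin. Qed.

Lemma Lp_norm_linear_le Omega (a r : R) (g h : E -> R) : 1 <= r -> measurable Omega ->
  measurable_fun Omega g -> measurable_fun Omega h ->
  (Lp_norm Omega r (fun x => (a * g x + h x)%:E)
   <= `|a|%:E * Lp_norm Omega r (fun x => (g x)%:E) + Lp_norm Omega r (fun x => (h x)%:E))%E.
Proof.
move=> r1 mO mg mh; rewrite !Lp_norm_EFin.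
have r0 : 0 < r := lt_le_trans ltr01 r1.
have mg' := (measurable_restrictT g mO).1 mg.
have mh' := (measurable_restrictT h mO).1 mh.
rewrite -Lnorm_scale//.
rewrite [X in EFin \o X](_ : _ = (fun x => a * (g \_ Omega) x) \+ h \_ Omega).
  by apply: minkowski_EFin => //; exact: measurable_funM.
by apply/funext => x; rewrite /= !patchE; case: ifPn => // _; rewrite mulr0 addr0.
Qed.

Lemma measurable_test_function Omega (D : set E) phi :
  test_function Omega phi -> measurable_fun D phi.
Proof.
move=> tphi; apply: measurable_funTS; apply: continuous_measurable_fun_rV.
exact: test_function_continuous tphi.
Qed.

Lemma crit_exp_ge1 : (3 <= N)%N -> 1 <= @crit_exp R N.
Proof.
move=> hN; have N3 : 3 <= N%:R :> R by rewrite (ler_nat _ 3).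
by rewrite /crit_exp ler_pdivlMr; lra.
Qed.

Lemma sqnorm_linear_le (a : R) (v w : E) :
  sqnorm (a *: v + w) <= 2 * a ^+ 2 * sqnorm v + 2 * sqnorm w.
Proof.
rewrite /sqnorm !mulr_sumr -big_split /=; apply: ler_sum => i _; rewrite !mxE.
by have := sqr_ge0 (a * v 0 i - w 0 i); nra.
Qed.

Lemma sqnormZ (a : R) (v : E) : sqnorm (a *: v) = a ^+ 2 * sqnorm v.
Proof.
by rewrite /sqnorm mulr_sumr; apply: eq_bigr => i _; rewrite mxE exprMn.
Qed.

Lemma sqnorm_eq0 (v : E) : sqnorm v = 0 -> v = 0.
Proof.
move=> v0; apply/rowP => i; rewrite mxE; apply/eqP; rewrite -sqrf_eq0; apply/eqP.
have /eqP := v0; rewrite psumr_eq0; last by move=> j _; exact: sqr_ge0.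
by move=> /allP/(_ i); rewrite mem_index_enum => /(_ isT)/eqP.
Qed.

Lemma ge0_integral_linear d (T : measurableType d) (m : {measure set T -> \bar R})
    (D : set T) (a b : R) (F1 F2 : T -> \bar R) : measurable D -> 0 <= a -> 0 <= b ->
  measurable_fun D F1 -> measurable_fun D F2 ->
  (forall x, D x -> 0 <= F1 x)%E -> (forall x, D x -> 0 <= F2 x)%E ->
  (\int[m]_(x in D) (a%:E * F1 x + b%:E * F2 x)
   = a%:E * \int[m]_(x in D) F1 x + b%:E * \int[m]_(x in D) F2 x)%E.
Proof.
move=> mD a0 b0 mF1 mF2 F10 F20.
rewrite -!ge0_integralZl_EFin// -ge0_integralD//.
- by move=> x Dx; rewrite mule_ge0 ?lee_fin// F10.
- exact: measurable_funeM.
- by move=> x Dx; rewrite mule_ge0 ?lee_fin// F20.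
- exact: measurable_funeM.
Qed.

Lemma cvge0_linear_squeeze (a : R) (s t r : nat -> \bar R) : 0 <= a ->
  (forall n, 0 <= r n <= a%:E * s n + t n)%E ->
  s @ \oo --> 0%E -> t @ \oo --> 0%E -> r @ \oo --> 0%E.
Proof.
move=> a0 rst cs ct.
apply: (@squeeze_cvge _ _ _ _ (cst 0%E) _ (fun n => a%:E * s n + t n)%E).
- by apply: nearW => n; exact: rst.
- exact: cvg_cst.
- rewrite -[X in _ --> X](_ : a%:E * 0 + 0 = 0)%E; last by rewrite mule0 adde0.
  by apply: cvgeD => //; exact: cvgeZl.
Qed.

Lemma sobolev0_gradient_linear Omega (a : R) u v G H : (3 <= N)%N -> measurable Omega ->
  sobolev0_gradient Omega u G -> sobolev0_gradient Omega v H ->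
  sobolev0_gradient Omega (fun x => a * u x + v x) (fun x => a *: G x + H x).
Proof.
move=> hN mO [mu_ mG [phi [tphi cu cG]]] [mv mH [psi [tpsi cv cH]]].
split.
- by apply: measurable_funD => //; exact: measurable_funM.
- exact: measurable_rV_linear.
exists (fun n x => a * phi n x + psi n x); split.
- by move=> n; exact: test_function_linear.
- apply: cvge0_linear_squeeze (normr_ge0 a) _ cu cv => n; rewrite Lnorm_ge0/=.
  have mp k : measurable_fun Omega (phi k).
    exact: measurable_test_function (tphi k).
  have mq k : measurable_fun Omega (psi k).
    exact: measurable_test_function (tpsi k).
  rewrite (_ : (fun x => _) = (fun x => (a * (phi n x - u x) + (psi n x - v x))%:E)).
    apply: Lp_norm_linear_le => //; first exact: crit_exp_ge1.
      exact: measurable_funB.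
    exact: measurable_funB.
  by apply/funext => x; congr EFin; ring.
- have a2 : 0 <= 2 * a ^+ 2 by rewrite mulr_ge0 ?sqr_ge0.
  have c2 : (fun n => 2%:E * \int[mu]_(x in Omega) (sqnorm (gradient (psi n) x - H x))%:E)%E
      @ \oo --> 0%E.
    by rewrite -[X in _ --> X](mule0 2%:E); apply: cvgeZl.
  apply: (cvge0_linear_squeeze a2 _ cG c2) => n.
  rewrite integral_ge0/=; last by move=> x _; rewrite lee_fin sqnorm_ge0.
  have mS (ph : E -> R) (F : E -> E) : test_function Omega ph -> measurable_fun Omega F ->
      measurable_fun Omega (fun x => (sqnorm (gradient ph x - F x))%:E).
    move=> tph mF; apply/measurable_EFinP/measurable_sqnorm.
    apply: (eq_measurable_fun (fun x => (-1) *: F x + gradient ph x)).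
      by move=> x _; rewrite scaleN1r addrC.
    by apply: measurable_rV_linear => //; apply: measurable_funTS; exact: measurable_gradient tph.
  rewrite -(ge0_integral_linear _ mO a2 (ler0n R 2))//; last 4 first.
  + exact: mS.
  + exact: mS.
  + by move=> x _; rewrite lee_fin sqnorm_ge0.
  + by move=> x _; rewrite lee_fin sqnorm_ge0.
  apply: ge0_le_integral => //.
  + by move=> x _; rewrite lee_fin sqnorm_ge0.
  + by apply: mS; [exact: test_function_linear|exact: measurable_rV_linear].
  + by apply: emeasurable_funD; apply: measurable_funeM; exact: mS.
  + move=> x _; rewrite -!EFinM -EFinD lee_fin (gradient_linear _ _ (tphi n) (tpsi n)).
    rewrite (_ : _ - _ = a *: (gradient (phi n) x - G x) + (gradient (psi n) x - H x)).
      exact: sqnorm_linear_le.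
    by rewrite scalerBr opprD addrACA.
Qed.

Lemma test_function_sobolev0_gradient Omega phi : (3 <= N)%N ->
  test_function Omega phi -> sobolev0_gradient Omega phi (gradient phi).
Proof.
move=> hN tphi; split.
- exact: measurable_test_function tphi.
- by apply: measurable_funTS; exact: measurable_gradient tphi.
exists (fun=> phi); split => //.
- under eq_fun do under eq_fun do rewrite subrr.
  rewrite (_ : (fun=> _) = cst 0%E); first exact: cvg_cst.
  apply/funext => _ /=; rewrite Lp_norm_EFin.
  have -> : (fun=> 0 : R) \_ Omega = cst 0 :> (E -> R).
    by apply/funext => x; rewrite patchE; case: ifP.
  by apply: Lnorm0; rewrite eqe gt_eqF// crit_exp_gt0.
- under eq_fun do under eq_integral do rewrite subrr.
  rewrite (_ : (fun=> _) = cst 0%E); first exact: cvg_cst.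
  apply/funext => _ /=; apply: integral0_eq => x _.
  by rewrite /sqnorm big1// => i _; rewrite mxE expr0n.
Qed.

Lemma sobolev0_gradientZ Omega (a : R) u G : (3 <= N)%N -> measurable Omega ->
  sobolev0_gradient Omega u G ->
  sobolev0_gradient Omega (fun x => a * u x) (fun x => a *: G x).
Proof.
move=> hN mO uG.
have := sobolev0_gradient_linear a hN mO uG
  (test_function_sobolev0_gradient hN (test_function0 Omega)).
congr (sobolev0_gradient _ _ _); apply/funext => x; first by rewrite addr0.
suff -> : gradient (fun=> 0) x = 0 :> E by rewrite addr0.
by apply/rowP => i; rewrite !mxE /partial (_ : (fun=> 0) = cst 0)// derive_cst.
Qed.

Lemma sobolev0_gradient_unique Omega u G H : (3 <= N)%N -> measurable Omega ->
  sobolev0_gradient Omega u G -> sobolev0_gradient Omega u H ->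
  ae_eq mu Omega G H.
Proof.
move=> hN mO uG uH; have [_ mG _] := uG; have [_ mH _] := uH.
have := sobolev0_gradient_linear (-1) hN mO uG uH.
rewrite (_ : (fun x => -1 * u x + u x) = (fun=> 0)); last first.
  by apply/funext => x; rewrite mulN1r addNr.
move=> /(gradient_closable hN mO) D0.
have mD : measurable_fun Omega (fun x => (sqnorm (-1 *: G x + H x))%:E).
  by apply/measurable_EFinP/measurable_sqnorm/measurable_rV_linear.
have : ae_eq mu Omega (fun x => (sqnorm (-1 *: G x + H x))%:E) (cst 0%E).
  apply/(ae_eq_integral_abs _ mO mD); rewrite -[RHS]D0; apply: eq_integral => x _.
  by rewrite gee0_abs// lee_fin sqnorm_ge0.
apply: filterS => x /= xD Ox; have [/sqnorm_eq0/eqP] := xD Ox.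
by rewrite scaleN1r addrC subr_eq0 => /eqP.
Qed.

(** [weak_gradient] is picked by choice. Uniqueness, obtained by applying closability to the
    difference of two gradients of u, allows any known gradient to compute the Dirichlet integral;
    scaling and convexity rest on this. *)
Lemma dirichletE Omega u G : (3 <= N)%N -> measurable Omega ->
  sobolev0_gradient Omega u G ->
  dirichlet Omega u = (\int[mu]_(x in Omega) (sqnorm (G x))%:E)%E.
Proof.
move=> hN mO uG; have uG' : sobolev0_gradient Omega u (weak_gradient Omega u).
  by apply: getPex; exists G.
have [_ mG _] := uG; have [_ mG' _] := uG'.
apply: ge0_ae_eq_integral => //.
- exact/measurable_EFinP/measurable_sqnorm.
- exact/measurable_EFinP/measurable_sqnorm.
- by move=> x _; rewrite lee_fin sqnorm_ge0.
- by move=> x _; rewrite lee_fin sqnorm_ge0.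
- by apply: filterS (sobolev0_gradient_unique hN mO uG' uG) => x xG /xG ->.
Qed.

Lemma dirichlet_ge0 Omega u : (0 <= dirichlet Omega u)%E.
Proof. by apply: integral_ge0 => x _; rewrite lee_fin sqnorm_ge0. Qed.

Lemma sobolev0_scale Omega (a : R) u : (3 <= N)%N -> measurable Omega ->
  sobolev0 Omega u -> sobolev0 Omega (fun x => a * u x).
Proof. by move=> hN mO [G uG]; exists (fun x => a *: G x); exact: sobolev0_gradientZ. Qed.

Lemma dirichletZ Omega (a : R) u : (3 <= N)%N -> measurable Omega ->
  sobolev0 Omega u ->
  dirichlet Omega (fun x => a * u x) = ((a ^+ 2)%:E * dirichlet Omega u)%E.
Proof.
move=> hN mO [G uG]; have [_ mG _] := uG.
rewrite (dirichletE hN mO (sobolev0_gradientZ a hN mO uG)) (dirichletE hN mO uG).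
rewrite -ge0_integralZl_EFin ?sqr_ge0//.
- by apply: eq_integral => x _; rewrite sqnormZ.
- by move=> x _; rewrite lee_fin sqnorm_ge0.
- exact/measurable_EFinP/measurable_sqnorm.
Qed.

Lemma sqnorm_midpoint_le (v w : E) :
  sqnorm (2^-1 *: v + 2^-1 *: w) <= 2^-1 * sqnorm v + 2^-1 * sqnorm w.
Proof.
rewrite /sqnorm !mulr_sumr -big_split /=; apply: ler_sum => i _; rewrite !mxE.
by have := sqr_ge0 (v 0 i - w 0 i); nra.
Qed.

Lemma sobolev0_midpoint Omega u v : (3 <= N)%N -> measurable Omega ->
  sobolev0 Omega u -> sobolev0 Omega v ->
  sobolev0 Omega (fun x => 2^-1 * u x + 2^-1 * v x) /\
  (dirichlet Omega (fun x => 2^-1 * u x + 2^-1 * v x)%R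
   <= (2^-1)%:E * dirichlet Omega u + (2^-1)%:E * dirichlet Omega v)%E.
Proof.
move=> hN mO [G uG] [H vH]; have [_ mG _] := uG; have [_ mH _] := vH.
have mid := sobolev0_gradient_linear 2^-1 hN mO uG (sobolev0_gradientZ 2^-1 hN mO vH).
split; first by eexists; exact: mid.
have mS F : measurable_fun Omega F -> measurable_fun Omega (fun x => (sqnorm (F x))%:E).
  by move=> mF; exact/measurable_EFinP/measurable_sqnorm.
have h0 : 0 <= 2^-1 :> R by rewrite invr_ge0.
rewrite (dirichletE hN mO mid) (dirichletE hN mO uG) (dirichletE hN mO vH).
rewrite -(ge0_integral_linear _ mO h0 h0)//; last 4 first.
- exact: mS.
- exact: mS.
- by move=> x _; rewrite lee_fin sqnorm_ge0.
- by move=> x _; rewrite lee_fin sqnorm_ge0.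
apply: ge0_le_integral => //.
- by move=> x _; rewrite lee_fin sqnorm_ge0.
- have [_ mM _] := mid; exact: mS mM.
- by apply: emeasurable_funD; apply: measurable_funeM; exact: mS.
- by move=> x _; rewrite -!EFinM -EFinD lee_fin; exact: sqnorm_midpoint_le.
Qed.

Lemma ae_eq_Lnorm (r : R) (g h : E -> R) :
  measurable_fun setT g -> measurable_fun setT h -> ae_eq mu setT g h ->
  ('N[mu]_r%:E[EFin \o g] = 'N[mu]_r%:E[EFin \o h])%E.
Proof.
move=> mg mh gh; rewrite unlock /=; congr (_ `^ _)%E.
have mP (w : E -> R) : measurable_fun setT w -> measurable_fun setT (fun x => (`|w x| `^ r)%:E).
  by move=> mw; apply/measurable_EFinP/(measurableT_comp (measurable_powR _))/measurableT_comp.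
apply: ae_eq_integral => //; [exact: mP|exact: mP|].
by apply: filterS gh => x + _ => ->.
Qed.

Lemma sobolev0_gradient_ae Omega u v G : measurable Omega ->
  measurable_fun Omega v -> ae_eq mu Omega u v ->
  sobolev0_gradient Omega u G -> sobolev0_gradient Omega v G.
Proof.
move=> mO mv uv [mu_ mG [phi [tphi cu cG]]]; split => //; exists phi; split => //.
rewrite (_ : (fun n => _)
  = (fun n => Lp_norm Omega (@crit_exp R N) (fun x => (phi n x - u x)%:E)))//.
apply/funext => n; rewrite !Lp_norm_EFin; apply: ae_eq_Lnorm.
- exact: ((measurable_restrictT _ mO).1 (measurable_funB (measurable_test_function (tphi n)) mv)).
- exact: ((measurable_restrictT _ mO).1 (measurable_funB (measurable_test_function (tphi n)) mu_)).
- by apply: filterS uv => x uvx _; rewrite !patchE; case: ifPn => // /set_mem/uvx ->.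
Qed.

End sobolev_space.

(** * Bounded linear functionals on the Sobolev space *)

Section dual.
Context {R : realType} {N : nat}.
Local Notation E := 'rV[R]_N.
Variables (Omega : set E) (f : (E -> R) -> R).
Hypotheses (hN : (3 <= N)%N) (mO : measurable Omega) (df : sobolev0_dual Omega f).

Let lin := df.1.

Lemma sobolev0_0 : sobolev0 Omega (fun=> 0).
Proof. by eexists; exact: test_function_sobolev0_gradient hN (test_function0 Omega). Qed.

Lemma sobolev0_dual0 : f (fun=> 0) = 0.
Proof.
have := lin 1 sobolev0_0 sobolev0_0.
rewrite (_ : (fun x => _) = (fun=> 0)); last by apply/funext => x; rewrite mulr0 addr0.
lra.
Qed.

Lemma sobolev0_dualZ (a : R) u : sobolev0 Omega u -> f (fun x => a * u x) = a * f u.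
Proof.
move=> su; have := lin a su sobolev0_0; rewrite sobolev0_dual0 addr0 => <-.
by congr f; apply/funext => x; rewrite addr0.
Qed.

Lemma sobolev0_dual_midpoint u v : sobolev0 Omega u -> sobolev0 Omega v ->
  f (fun x => 2^-1 * u x + 2^-1 * v x) = 2^-1 * f u + 2^-1 * f v.
Proof.
by move=> su sv; rewrite lin// ?sobolev0_dualZ//; exact: sobolev0_scale.
Qed.

(** The free radius e > 0 avoids dividing by a norm that may vanish. Functions with zero Dirichlet
    integral are covered by letting e tend to 0. *)
Lemma sobolev0_dual_le (e : R) u : 0 < e -> sobolev0 Omega u ->
  (dirichlet Omega u <= (e ^+ 2)%:E)%E -> `|f u| <= fine (dual_norm Omega f) * e.
Proof.
move=> e0 su due.
have sw := sobolev0_scale e^-1 hN mO su.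
have dw : (dirichlet Omega (fun x => e^-1 * u x)%R <= 1)%E.
  rewrite dirichletZ//; apply: (@le_trans _ _ ((e^-1 ^+ 2)%:E * (e ^+ 2)%:E)%E).
    by apply: lee_wpmul2l => //; rewrite lee_fin sqr_ge0.
  by rewrite -EFinM lee_fin -exprMn mulVf ?gt_eqF// expr1n.
have nw : (sobolev0_norm Omega (fun x => e^-1 * u x)%R <= 1)%E.
  rewrite /sobolev0_norm -(poweR1r 2^-1); apply: gt0_ler_poweR => //.
  - by rewrite in_itv/= leey dirichlet_ge0.
  - by rewrite in_itv/= leey lee_fin ler01.
have fw : (`|f (fun x => e^-1 * u x)|%:E <= dual_norm Omega f)%E.
  by apply: ereal_sup_ubound; exists (fun x => e^-1 * u x).
have dfin : dual_norm Omega f \is a fin_num.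
  by rewrite ge0_fin_numE ?df.2// (le_trans _ fw)// lee_fin.
move: fw; rewrite -(fineK dfin) lee_fin sobolev0_dualZ// normrM.
by rewrite normfV (gtr0_norm e0) mulrC ler_pdivrMr.
Qed.

End dual.

(** * The minimizer does not vanish *)

Section nontrivial_minimizer.
Context {R : realType} {N : nat}.
Local Notation E := 'rV[R]_N.
Local Notation mu := (lebesgue_rV N).
Variables (Omega : set E) (p : R) (f : (E -> R) -> R).
Hypotheses (hN : (3 <= N)%N) (mO : measurable Omega) (hp : 1 < p).
Hypothesis df : sobolev0_dual Omega f.

Lemma norm_le_all_eq0 (x M : R) : (forall e, 0 < e -> `|x| <= M * e) -> x = 0.
Proof.
move=> h; apply/eqP; rewrite -normr_le0 leNgt; apply/negP => x0.
have M1 : 0 < `|M| + 1 by rewrite ltr_wpDl.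
have := h (`|x| / (2 * (`|M| + 1))); rewrite divr_gt0// ?mulr_gt0// => /(_ isT).
apply/negP; rewrite -ltNge mulrCA -[ltRHS]mulr1 ltr_pM2l// ltr_pdivrMr ?mulr_gt0// mul1r.
by have := ler_norm M; lra.
Qed.

Lemma measurable_powR_norm (r : R) (u : E -> R) : measurable_fun Omega u ->
  measurable_fun Omega (fun x => (`|u x| `^ r)%:E).
Proof.
by move=> mu_; apply/measurable_EFinP/(measurableT_comp (measurable_powR _))/measurableT_comp.
Qed.

Lemma dirichlet_ae_eq0 u : sobolev0 Omega u -> ae_eq mu Omega u (fun=> 0) ->
  dirichlet Omega u = 0%E.
Proof.
move=> [G uG] u0; rewrite (dirichletE hN mO uG).
by apply: gradient_closable => //; apply: sobolev0_gradient_ae u0 uG.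
Qed.

Lemma dirichlet_test_function_lty phi : test_function Omega phi ->
  (dirichlet Omega phi < +oo)%E.
Proof.
move=> tphi; rewrite (dirichletE hN mO (test_function_sobolev0_gradient hN tphi)).
have := integrable_lty mO (integrable_dot_gradient mO tphi tphi).
by congr (_ < _)%E; apply: eq_integral.
Qed.

(** Density: subtracting an approximating test function from v leaves f v unchanged and makes the
    Dirichlet integral smaller than e^2. *)
Lemma sobolev0_dual_test_functions :
  (forall phi, test_function Omega phi -> f phi = 0) ->
  forall v, sobolev0 Omega v -> f v = 0.
Proof.
move=> f0 v [G vG]; have [_ mG [phi [tphi _ cG]]] := vG.
apply: (norm_le_all_eq0 (M := fine (dual_norm Omega f))) => e e0.
have [n _ /(_ n (leqnn n)) Sn] := cvge0_near_lt (exprn_gt0 2 e0) cG.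
have tG := test_function_sobolev0_gradient hN (tphi n).
have wG := sobolev0_gradient_linear (-1) hN mO tG vG.
have -> : f v = f (fun x => -1 * phi n x + v x).
  rewrite df.1; [by rewrite (f0 _ (tphi n)) mulr0 add0r|by exists (gradient (phi n))|by exists G].
apply: sobolev0_dual_le => //; first by eexists; exact: wG.
rewrite (dirichletE hN mO wG); apply: le_trans (ltW Sn).
rewrite le_eqVlt; apply/orP; left; apply/eqP; apply: eq_integral => x _.
rewrite (_ : _ + _ = -1 *: (gradient (phi n) x - G x)).
  by rewrite sqnormZ sqrrN expr1n mul1r.
by rewrite scalerBr !scaleN1r opprK.
Qed.

(** If the integral vanished, then u0 = 0 almost everywhere and J(u0) = 0. For a test function phi
    the value J(t phi) is a finite quadratic polynomial in t with linear coefficient - f phi, so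
    minimality forces f phi = 0; by density f would be zero. *)
Lemma minimizer_J_integral_gt0 u0 : dual_nonzero Omega f -> is_minimizer_J Omega p f u0 ->
  (0 < \int[mu]_(x in Omega) (`|u0 x| `^ (2 * p / (p + 1)))%:E)%E.
Proof.
move=> [v sv fv] [su0 minu0].
have p1 := hp; have p0 : 0 < p := lt_trans ltr01 hp.
have q0 : 0 < 2 * p / (p + 1) by apply: divr_gt0; lra.
have qp : 2 * p / (p + 1) * ((p + 1) / p) = 2 by field; apply/andP; split; rewrite gt_eqF//; lra.
rewrite lt0e integral_ge0 ?andbT; last by move=> x _; rewrite lee_fin powR_ge0.
apply/eqP => A0; move/eqP: fv; apply; apply: sobolev0_dual_test_functions sv => phi tphi.
have [G u0G] := su0; have [mu0 _ _] := u0G.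
have u0_ae : ae_eq mu Omega u0 (fun=> 0).
  have : ae_eq mu Omega (fun x => (`|u0 x| `^ (2 * p / (p + 1)))%:E) (cst 0%E).
    apply/(ae_eq_integral_abs _ mO (measurable_powR_norm _ mu0)); rewrite -[RHS]A0.
    by apply: eq_integral => x _; rewrite gee0_abs// lee_fin powR_ge0.
  by apply: filterS => x xA Ox; have [/powR_eq0_eq0/eqP] := xA Ox; rewrite normr_eq0 => /eqP.
have D0 := dirichlet_ae_eq0 su0 u0_ae.
have fu0 : f u0 = 0.
  apply: (norm_le_all_eq0 (M := fine (dual_norm Omega f))) => e e0.
  by apply: sobolev0_dual_le => //; rewrite D0 lee_fin sqr_ge0.
have J0 : J_functional Omega p f u0 = 0%E.
  rewrite /J_functional D0 A0 fu0 poweR0r; last by rewrite gt_eqF// divr_gt0//; lra.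
  by rewrite !mule0 adde0 sube0.
have sphi : sobolev0 Omega phi.
  by exists (gradient phi); exact: test_function_sobolev0_gradient.
have Dfin : dirichlet Omega phi \is a fin_num.
  by rewrite ge0_fin_numE ?dirichlet_ge0// dirichlet_test_function_lty.
have Ifin : (\int[mu]_(x in Omega) (`|phi x| `^ (2 * p / (p + 1)))%:E)%E \is a fin_num.
  apply: integrable_fin_num => //; apply: (integrableS measurableT) => //.
  apply: powR_bounded_support_integrable => //.
    exact: test_function_continuous tphi.
  exact: test_function_bounded_support tphi.
set I := (\int[mu]_(x in Omega) _)%E in Ifin.
pose a := fine (dirichlet Omega phi); pose b := fine I `^ ((p + 1) / p).
have a0 : 0 <= a by rewrite fine_ge0// dirichlet_ge0.
have b0 : 0 <= b by exact: powR_ge0.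
have Jphi t : J_functional Omega p f (fun x => t * phi x)
    = (2^-1 * (t ^+ 2 * a) + 2^-1 * (t ^+ 2 * b) - t * f phi)%:E.
  rewrite /J_functional dirichletZ// (sobolev0_dualZ hN df)//.
  rewrite (_ : (\int[mu]_(x in Omega) _)%E = ((`|t| `^ (2 * p / (p + 1)))%:E * I)%E).
    rewrite poweRM ?lee_fin ?powR_ge0//; last first.
      by apply: integral_ge0 => x _; rewrite lee_fin powR_ge0.
    rewrite poweR_EFin -powRrM qp -[2]/(2%:R) powR_mulrn// real_normK ?num_real//.
    by rewrite -(fineK Dfin) -(fineK Ifin) poweR_EFin -!EFinM -EFinD.
  rewrite -ge0_integralZl_EFin ?powR_ge0//; last first.
    by apply: measurable_powR_norm; exact: measurable_test_function tphi.
  by apply: eq_integral => x _; rewrite normrM powRM// EFinM.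
apply/eqP; apply: contraT => fphi.
(* With t = f phi / (a + b + 1) one gets J(t phi) = - t^2 ((a + b)/2 + 1); the added 1 keeps the
   denominator positive even if a = b = 0. *)
have := minu0 _ (sobolev0_scale (f phi / (a + b + 1)) hN mO sphi).
rewrite J0 Jphi lee_fin leNgt => /negP[].
have K0 : 0 < a + b + 1 by lra.
rewrite (_ : _ - _ = - ((f phi / (a + b + 1)) ^+ 2 * (2^-1 * (a + b) + 1))).
  by rewrite oppr_lt0 mulr_gt0//; [rewrite exprn_even_gt0//= mulf_neq0// invr_neq0// gt_eqF|lra].
by field; rewrite gt_eqF.
Qed.

End nontrivial_minimizer.

(** * Hoelder and uniform convexity in L^p *)

(** Sum of the two tangent-line bounds at the midpoint h, whose linear terms cancel. *)
Lemma powR_midpoint_le {R : realType} (p a b : R) : 1 <= p -> 0 <= a -> 0 <= b ->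
  ((a + b) / 2) `^ p <= (a `^ p + b `^ p) / 2.
Proof.
move=> p1 a0 b0; have p0 : p != 0 by rewrite gt_eqF//; lra.
have [ab0|abn0] := eqVneq (a + b) 0.
  by rewrite ab0 mul0r powR0// divr_ge0// addr_ge0 ?powR_ge0.
have h0 : 0 < (a + b) / 2 by rewrite divr_gt0// lt_def abn0 addr_ge0.
set h := (a + b) / 2 in h0 *.
have H x : 0 <= x -> h `^ p * (1 + p * (x / h - 1)) <= x `^ p.
  move=> x0; have xh : 0 <= x / h by rewrite divr_ge0// ltW.
  have {2}-> : x = h * (x / h) by field; rewrite gt_eqF.
  by rewrite (powRM _ (ltW h0) xh) ler_wpM2l ?powR_ge0// bernoulli_powR.
have := H a a0; have := H b b0.
suff : h `^ p * (1 + p * (a / h - 1)) + h `^ p * (1 + p * (b / h - 1)) = 2 * h `^ p by lra.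
by rewrite /h; field.
Qed.

Section integral_inequalities.
Context d (T : measurableType d) {R : realType} (mu : {measure set T -> \bar R}).
Variables (D : set T) (mD : measurable D).

Lemma measurable_powR_comp (g : T -> R) (r : R) :
  measurable_fun D g -> measurable_fun D (fun x => g x `^ r).
Proof. by move=> mg; apply: (measurableT_comp (measurable_powR r)). Qed.

(** The exponent 0 is excluded because 0^0 = 1 would count the complement of D. *)
Lemma Lnorm_restrict (g : T -> R) (r : R) : r != 0 ->
  ('N[mu]_r%:E[EFin \o (g \_ D)] = (\int[mu]_(x in D) (`|g x| `^ r)%:E) `^ r^-1)%E.
Proof.
move=> r0; rewrite unlock /= [in RHS]integral_mkcond; congr (_ `^ _)%E.
apply: eq_integral => x _; rewrite !patchE; case: ifPn => //= _.
by rewrite normr0 powR0.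
Qed.

(** With q = 2p/(p+1) this is ||m||_q^2 <= (int m^2/z) ||z||_p, written with t in place of the
    quotient so that zeros of z cause no trouble. Raising m^2 <= t z to the power p/(p+1) gives
    |m|^q on the left, and Hoelder with exponents (p+1)/p and p+1 applies to the right. *)
Lemma hoelder_quotient (p : R) (m t z : T -> R) : 1 < p ->
  measurable_fun D m -> measurable_fun D t -> measurable_fun D z ->
  (forall x, D x -> 0 <= t x) -> (forall x, D x -> 0 <= z x) ->
  {ae mu, forall x, D x -> m x ^+ 2 <= t x * z x} ->
  ((\int[mu]_(x in D) (`|m x| `^ (2 * p / (p + 1)))%:E) `^ ((p + 1) / p)
   <= (\int[mu]_(x in D) (t x)%:E) * (\int[mu]_(x in D) (z x `^ p)%:E) `^ (p^-1))%E.
Proof.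
move=> p1 mm mt mz t0 z0 mtz.
have p_gt0 : 0 < p by lra.
have p1_gt0 : 0 < p + 1 by lra.
pose r := p / (p + 1).
have r0 : 0 < r by rewrite divr_gt0.
have mtr := measurable_powR_comp r mt; have mzr := measurable_powR_comp r mz.
have mf := (measurable_restrictT _ mD).1 mtr.
have mg := (measurable_restrictT _ mD).1 mzr.
have conj : ((p + 1) / p)^-1 + (p + 1)^-1 = 1 by field; rewrite !gt_eqF.
set I := (\int[mu]_(x in D) (t x)%:E)%E; set Z := (\int[mu]_(x in D) (z x `^ p)%:E)%E.
have NI : ('N[mu]_((p + 1) / p)%:E[EFin \o ((fun x => t x `^ r)%R \_ D)]
    = I `^ ((p + 1) / p)^-1)%E.
  rewrite (Lnorm_restrict _ (lt0r_neq0 (divr_gt0 p1_gt0 p_gt0))); congr (_ `^ _)%E.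
  apply: eq_integral => x /set_mem Dx; rewrite ger0_norm ?powR_ge0// -powRrM.
  by rewrite (_ : r * _ = 1) ?powRr1 ?t0// /r; field; rewrite !gt_eqF.
have NZ : ('N[mu]_(p + 1)%:E[EFin \o ((fun x => z x `^ r)%R \_ D)]
    = Z `^ (p + 1)^-1)%E.
  rewrite (Lnorm_restrict _ (lt0r_neq0 p1_gt0)); congr (_ `^ _)%E.
  apply: eq_integral => x /set_mem Dx; rewrite ger0_norm ?powR_ge0// -powRrM.
  by rewrite (_ : r * _ = p)// /r; field; rewrite !gt_eqF.
have := hoelder mu mf mg (divr_gt0 p1_gt0 p_gt0) p1_gt0 conj.
rewrite NI NZ.
have I0 : (0 <= I)%E by apply: integral_ge0 => x Dx; rewrite lee_fin t0.
have Z0 : (0 <= Z)%E by apply: integral_ge0 => x _; rewrite lee_fin powR_ge0.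
rewrite Lnorm1 => le1.
have le2 : (\int[mu]_(x in D) (`|m x| `^ (2 * p / (p + 1)))%:E
    <= I `^ ((p + 1) / p)^-1 * Z `^ (p + 1)^-1)%E.
  apply: le_trans le1.
  rewrite [leRHS](_ : _ = \int[mu]_(x in D) (t x `^ r * z x `^ r)%:E)%E; last first.
    rewrite [RHS]integral_mkcond; apply: eq_integral => x _; rewrite /= !patchE.
    by case: ifPn => _ /=; rewrite ?mulr0 ?normr0// ger0_norm ?mulr_ge0 ?powR_ge0.
  apply: ae_ge0_le_integral => //.
  - by apply/measurable_EFinP/measurable_powR_comp/measurableT_comp.
  - by move=> x _; rewrite lee_fin mulr_ge0 ?powR_ge0.
  - by apply/measurable_EFinP; exact: measurable_funM.
  - apply: filterS mtz => x mtzx Dx; rewrite lee_fin.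
    rewrite (_ : 2 * p / (p + 1) = 2%:R * r); last by rewrite /r mulrA.
    rewrite powRrM powR_mulrn// real_normK ?num_real// -powRM ?t0 ?z0//.
    apply: ge0_ler_powR (mtzx Dx); rewrite ?nnegrE ?sqr_ge0 ?(ltW r0)//.
    by rewrite mulr_ge0 ?t0 ?z0.
apply: (@le_trans _ _ ((I `^ ((p + 1) / p)^-1 * Z `^ (p + 1)^-1) `^ ((p + 1) / p))%E).
  apply: gt0_ler_poweR => //.
  - by rewrite divr_ge0 ?ltW.
  - by rewrite in_itv/= leey integral_ge0// => x _; rewrite lee_fin powR_ge0.
  - by rewrite in_itv/= leey mule_ge0 ?poweR_ge0.
rewrite poweRM ?poweR_ge0// -!poweRrM mulVf ?poweRe1//; last first.
  by rewrite gt_eqF// divr_gt0.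
by rewrite (_ : (p + 1)^-1 * ((p + 1) / p) = p^-1)//; field; rewrite !gt_eqF.
Qed.

(** Uniform convexity of the unit ball of L^p in terms of p-th powers of norms, from integrating
    [powR_midpoint_gap]. The bound X <= 2 is kept because it later pays for raising the exponent of
    X. *)
Lemma integral_powR_midpoint_gap (p : R) (v w : T -> R) : 1 < p ->
  measurable_fun D v -> measurable_fun D w ->
  (forall x, D x -> 0 <= v x) -> (forall x, D x -> 0 <= w x) ->
  (\int[mu]_(x in D) (v x `^ p)%:E <= 1)%E ->
  (\int[mu]_(x in D) (w x `^ p)%:E <= 1)%E ->
  exists X Z : R, [/\ 0 <= X <= 2, 0 <= Z,
    (\int[mu]_(x in D) (`|v x - w x| `^ p)%:E = X%:E)%E,
    (\int[mu]_(x in D) (((v x + w x) / 2) `^ p)%:E = Z%:E)%E &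
    Num.min 1 ((p - 1) ^+ 2) * X ^+ 2 <= 2 `^ (2 * p + 2) * (1 - Z)].
Proof.
move=> p1 mv mw v0 w0 v1 w1; set c := Num.min _ _.
have p0 : 0 < p by lra.
have c0 : 0 < c by rewrite lt_min ltr01 exprn_gt0// subr_gt0.
have intP (g : T -> R) : measurable_fun D g -> (\int[mu]_(x in D) (g x `^ p)%:E <= 1)%E ->
    mu.-integrable D (EFin \o (fun x => g x `^ p)).
  move=> mg g1; apply/integrableP; split; first exact/measurable_EFinP/measurable_powR_comp.
  under eq_integral do rewrite /= ger0_norm ?powR_ge0//.
  by rewrite (le_lt_trans g1)// ltry.
have iv := intP v mv v1; have iw := intP w mw w1.
have ivw := integrableD mD iv iw.
have mX : measurable_fun D (fun x => `|v x - w x| `^ p).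
  by apply: measurable_powR_comp; apply: measurableT_comp => //; exact: measurable_funB.
have mZ : measurable_fun D (fun x => ((v x + w x) / 2) `^ p).
  by apply: measurable_powR_comp; apply: measurable_funM => //; exact: measurable_funD.
have Xle x : D x -> `|v x - w x| `^ p <= v x `^ p + w x `^ p.
  move=> Dx; have := v0 x Dx; have := w0 x Dx => wx vx.
  have [vw|/ltW vw] := leP (v x) (w x).
    rewrite ler_wpDl ?powR_ge0// ge0_ler_powR ?nnegrE ?(ltW p0)//.
    by rewrite distrC ger0_norm ?subr_ge0// gerBl.
  rewrite ler_wpDr ?powR_ge0// ge0_ler_powR ?nnegrE ?(ltW p0)//.
  by rewrite ger0_norm ?subr_ge0// gerBl.
have Zle x : D x -> ((v x + w x) / 2) `^ p <= (v x `^ p + w x `^ p) / 2.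
  by move=> Dx; apply: powR_midpoint_le; rewrite ?v0 ?w0// ltW.
have iX : mu.-integrable D (EFin \o (fun x => `|v x - w x| `^ p)).
  apply: le_integrable ivw => //; first exact/measurable_EFinP.
  move=> x Dx /=; rewrite lee_fin ger0_norm ?powR_ge0//.
  by rewrite [leRHS]ger0_norm ?addr_ge0 ?powR_ge0 ?Xle.
have iZ : mu.-integrable D (EFin \o (fun x => ((v x + w x) / 2) `^ p)).
  apply: le_integrable ivw => //; first exact/measurable_EFinP.
  move=> x Dx /=; rewrite lee_fin ger0_norm ?powR_ge0//.
  rewrite [leRHS]ger0_norm ?addr_ge0 ?powR_ge0//; apply: le_trans (Zle x Dx) _.
  by rewrite ler_pdivrMr// mulr_natr mulr2n lerDl addr_ge0 ?powR_ge0.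
set X := Rintegral mu D (fun x => `|v x - w x| `^ p).
set Z := Rintegral mu D (fun x => ((v x + w x) / 2) `^ p).
set S := Rintegral mu D (fun x => v x `^ p + w x `^ p).
have S2 : S <= 2.
  rewrite /S RintegralD//.
  have le1 g : mu.-integrable D (EFin \o g) -> (\int[mu]_(x in D) (g x)%:E <= 1)%E ->
      Rintegral mu D g <= 1.
    by move=> ig g1; rewrite -lee_fin /Rintegral fineK//; exact: integrable_fin_num.
  by rewrite [leRHS](_ : 2 = 1 + 1)// lerD ?le1.
have iS : mu.-integrable D (EFin \o (fun x => v x `^ p + w x `^ p)) := ivw.
have X0 : 0 <= X by apply: Rintegral_ge0 => x _; exact: powR_ge0.
have Z0 : 0 <= Z by apply: Rintegral_ge0 => x _; exact: powR_ge0.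
have XS : X <= S by apply: le_Rintegral.
have ZS : Z <= S / 2.
  have iS2 : mu.-integrable D (EFin \o (fun x => (v x `^ p + w x `^ p) / 2)).
    have := integrableZl mD 2^-1 iS; apply: eq_integrable => // x _ /=.
    by rewrite -EFinM mulrC.
  by rewrite -RintegralZr//; apply: le_Rintegral.
exists X, Z; split => //.
- by rewrite X0 (le_trans XS).
- by rewrite /X /Rintegral fineK//; exact: integrable_fin_num.
- by rewrite /Z /Rintegral fineK//; exact: integrable_fin_num.
have [->|Xn0] := eqVneq X 0.
  by rewrite expr0n/= mulr0 mulr_ge0 ?powR_ge0//; lra.
have Xp : 0 < X by rewrite lt_def Xn0.
have key e : 0 < e -> X <= 2 `^ p * (e + (1 - Z) / (c * e)).
  move=> e0; have ce : 0 < c * e by rewrite mulr_gt0.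
  (* Coefficients of int (v^p + w^p) and of Z in the integrated inequality. The sign of b is
     unknown, so only the first integral is replaced by its bound 2; Z <= 1 is used on the term in e
     alone. *)
  pose a := 2 `^ p / (2 * (c * e)); pose b := 2 `^ p * (e - (c * e)^-1).
  have a0 : 0 <= a by rewrite divr_ge0 ?powR_ge0// mulr_ge0// ltW.
  have -> : 2 `^ p * (e + (1 - Z) / (c * e)) = a * 2 + b * Z + 2 `^ p * e * (1 - Z).
    by rewrite /a /b; field; rewrite !gt_eqF.
  apply: (@le_trans _ _ (a * S + b * Z)); last first.
    rewrite -[leLHS]addr0; apply: lerD; first by rewrite lerD2r ler_wpM2l.
    by rewrite mulr_ge0 ?mulr_ge0 ?powR_ge0 ?(ltW e0)//; lra.
  have iaS := integrableZl mD a iS; have ibZ := integrableZl mD b iZ.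
  rewrite -!RintegralZl// -RintegralD//; apply: le_Rintegral => //.
    by have := integrableD mD iaS ibZ; apply: eq_integrable.
  move=> x Dx; apply: le_trans (powR_midpoint_gap p1 (v0 x Dx) (w0 x Dx) e0) _.
  rewrite -/c le_eqVlt; apply/orP; left; apply/eqP.
  by rewrite /a /b; field; rewrite !gt_eqF.
have P0 : 0 < 2 `^ p :> R by rewrite powR_gt0.
(* This e makes the first term equal to X/2, which the left-hand side absorbs; what remains is
   quadratic in X. *)
have := key (X / (2 * 2 `^ p)); rewrite divr_gt0 ?mulr_gt0// => /(_ isT).
have -> : 2 `^ (2 * p + 2) = 4 * (2 `^ p) ^+ 2 :> R.
  rewrite powRD; last by rewrite (_ : (2 : R) != 0) ?implybT.
  rewrite mulrC [2 * p]mulrC powRrM -[in X in _ * X `^ _ = _]/(2%:R).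
  by rewrite -![X in _ `^ X]/(2%:R) !powR_mulrn ?powR_ge0//; ring.
have -> : 2 `^ p * (X / (2 * 2 `^ p) + (1 - Z) / (c * (X / (2 * 2 `^ p))))
    = X / 2 + 2 * (2 `^ p) ^+ 2 * (1 - Z) / (c * X).
  by field; rewrite !gt_eqF.
move=> h; have : X / 2 <= 2 * (2 `^ p) ^+ 2 * (1 - Z) / (c * X) by lra.
by rewrite ler_pdivlMr ?mulr_gt0//; lra.
Qed.

End integral_inequalities.

(* Titu's inequality, i.e. the joint convexity of (u, w) |-> u^2 / w. *)
Lemma sqr_midpoint_le {R : realType} (t t' v v' x y : R) : 0 <= t -> 0 <= t' -> 0 <= v -> 0 <= v' ->
  t * v = x ^+ 2 -> t' * v' = y ^+ 2 ->
  (2^-1 * x + 2^-1 * y) ^+ 2 <= (2^-1 * t + 2^-1 * t') * ((v + v') / 2).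
Proof.
move=> t_ge0 t'_ge0 v_ge0 v'_ge0 tv tv'.
have s0 : 0 <= t * v' + t' * v by rewrite addr_ge0// mulr_ge0.
have : `|2 * (x * y)| <= `|t * v' + t' * v|.
  rewrite -ler_sqr ?nnegrE// !real_normK ?num_real//.
  have -> : (2 * (x * y)) ^+ 2 = 4 * ((t * v') * (t' * v)).
    by rewrite [t * v' * _]mulrACA [v' * v]mulrC mulrACA tv tv'; ring.
  by have := sqr_ge0 (t * v' - t' * v); nra.
rewrite (ger0_norm s0) => h; have := le_trans (ler_norm _) h.
by move: tv tv'; nra.
Qed.

(** Here b stands for c2^2, z for the norm of (W + W0)/2, and Dm, M for the two nonlinear terms of J
    at the midpoint. Doubling the minimality inequality cancels half of each Dirichlet term and
    leaves (I + b)(1 - z)/2, where I is dropped since I >= 0 and z <= 1. Dm and M may a priori be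
    infinite, so they are replaced by their real bounds before the computation moves to R. *)
Lemma midpoint_gap_arith {R : realType} (Du Du0 Dm M I : \bar R) (b z fu fu0 : R) :
  Du \is a fin_num -> Du0 \is a fin_num -> I \is a fin_num -> (0 <= I)%E -> z <= 1 ->
  (Dm <= (2^-1)%:E * Du + (2^-1)%:E * Du0)%E ->
  (M <= ((2^-1 * fine I + 2^-1 * b) * z)%:E)%E ->
  ((2^-1 * fine Du0 + 2^-1 * b - fu0)%:E
   <= (2^-1)%:E * Dm + (2^-1)%:E * M - (2^-1 * fu + 2^-1 * fu0)%:E)%E ->
  ((2^-1 * fine Du0 + 2^-1 * b - fu0)%:E + (2^-1 * b * (1 - z))%:E
   <= (2^-1)%:E * Du + (2^-1)%:E * I - fu%:E)%E.
Proof.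
move=> /fineK <- /fineK <- /fineK <- /=.
move: (fine Du) (fine Du0) (fine I) => du du0 i; rewrite lee_fin => i0 z1 Dm_le M_le J_le.
have h0 : (0 <= (2^-1)%:E :> \bar R)%E by rewrite lee_fin invr_ge0.
have : ((2^-1 * du0 + 2^-1 * b - fu0)%:E
    <= (2^-1)%:E * ((2^-1)%:E * du%:E + (2^-1)%:E * du0%:E)
       + (2^-1)%:E * ((2^-1 * i + 2^-1 * b) * z)%:E - (2^-1 * fu + 2^-1 * fu0)%:E)%E.
  apply: le_trans J_le _; apply: (leeD _ (lexx _)).
  by apply: leeD; exact: lee_wpmul2l.
rewrite -?EFinM -?EFinD -?EFinM -?EFinD !lee_fin.
by nra.
Qed.

(** The minimum and 2^(2p+2) come from [integral_powR_midpoint_gap], the factor p from 1 - Z^(1/p)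
    >= (1 - Z)/p, the factor 2 from the one half in the energy, and 2^(4/(p-1)) from bounding
    X^(4/(p-1)) by means of X <= 2. *)
Definition stability_rate {R : realType} (p : R) : R :=
  Num.min 1 ((p - 1) ^+ 2) / (2 * p * 2 `^ (2 * p + 2) * 2 `^ (4 / (p - 1))).

Lemma stability_rate_gt0 {R : realType} (p : R) : 1 < p -> 0 < stability_rate p.
Proof.
move=> p1; rewrite divr_gt0 ?lt_min ?ltr01 ?exprn_gt0 ?subr_gt0//.
by rewrite !mulr_gt0 ?powR_gt0//; lra.
Qed.

Lemma stability_rate_le {R : realType} (p X Z : R) : 1 < p -> 0 <= X <= 2 -> 0 <= Z ->
  Num.min 1 ((p - 1) ^+ 2) * X ^+ 2 <= 2 `^ (2 * p + 2) * (1 - Z) ->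
  stability_rate p * X `^ (2 * (p + 1) / (p - 1)) <= 2^-1 * (1 - Z `^ p^-1).
Proof.
move=> p1 /andP[X0 X2] Z0; rewrite /stability_rate; set c := Num.min _ _ => h.
have p0 : 0 < p by lra.
have c0 : 0 < c by rewrite lt_min ltr01 exprn_gt0// subr_gt0.
have P0 : 0 < 2 `^ (2 * p + 2) :> R by rewrite powR_gt0.
have Q0 : 0 < 2 `^ (4 / (p - 1)) :> R by rewrite powR_gt0.
have rn : 0 <= 4 / (p - 1) by rewrite divr_ge0//; lra.
have XE : X `^ (2 * (p + 1) / (p - 1)) <= X ^+ 2 * 2 `^ (4 / (p - 1)).
  (* X is the p-th power of the norm, so this is the required exponent 2p(p+1)/(p-1) divided by p.
     Its surplus over the available exponent 2 is 4/(p-1). *)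
  rewrite (_ : 2 * (p + 1) / (p - 1) = 2 + 4 / (p - 1)); last first.
    by field; rewrite gt_eqF// subr_gt0.
  have [->|Xn0] := eqVneq X 0.
    by rewrite powR0 ?mulr_ge0 ?powR_ge0 ?sqr_ge0// gt_eqF//; lra.
  rewrite powRD ?Xn0 ?implybT// (powR_mulrn 2 X0) ler_wpM2l ?sqr_ge0//.
  by rewrite ge0_ler_powR ?nnegrE.
have ZE : Z `^ p^-1 <= 1 + p^-1 * (Z - 1).
  by apply: le1_bernoulli_powR => //; rewrite invr_gt0 p0 invf_le1// ltW.
apply: (@le_trans _ _ (c / (2 * p * 2 `^ (2 * p + 2) * 2 `^ (4 / (p - 1)))
    * (X ^+ 2 * 2 `^ (4 / (p - 1))))).
  by apply: ler_wpM2l => //; exact: ltW (stability_rate_gt0 p1).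
rewrite (_ : _ * _ = c * X ^+ 2 / 2 `^ (2 * p + 2) / (2 * p)); last first.
  by field; rewrite !gt_eqF.
apply: (@le_trans _ _ ((1 - Z) / (2 * p))).
  apply: ler_wpM2r; first by rewrite invr_ge0 mulr_ge0 ?(ltW p0).
  by rewrite ler_pdivrMr// [leRHS]mulrC.
rewrite (_ : (1 - Z) / (2 * p) = 2^-1 * (p^-1 * (1 - Z))); last by field; rewrite gt_eqF.
by rewrite ler_pM2l ?invr_gt0//; lra.
Qed.

(** * Stability of the optimal potential *)

Section potentials.
Context {R : realType} {N : nat}.
Local Notation E := 'rV[R]_N.
Local Notation mu := (lebesgue_rV N).
Variables (Omega : set E) (p : R) (f : (E -> R) -> R) (u0 : E -> R).
Hypotheses (hN : (3 <= N)%N) (mO : measurable Omega) (hp : 1 < p).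
Hypotheses (df : sobolev0_dual Omega f) (nf : dual_nonzero Omega f).
Hypothesis min0 : is_minimizer_J Omega p f u0.

Local Notation A := (\int[mu]_(x in Omega) (`|u0 x| `^ (2 * p / (p + 1)))%:E)%E.
Local Notation a := (fine A).
Local Notation r := ((p + 1) / p).
Local Notation U0 := (optimal_potential Omega p u0).

(** 1/U0 as a real function: the exponent 2/(p+1) is positive, so the value 0 at zeros of u0 needs
    no separate case. *)
Definition optimal_inverse (x : E) : R := a `^ (- p^-1) * `|u0 x| `^ (2 / (p + 1)).

(** The integrand U0 u0^2, with exponent 2 - 2/(p+1) = 2p/(p+1); at zeros of u0 it is 0, in
    accordance with +oo * 0 = 0. *)
Definition optimal_density (x : E) : R := a `^ p^-1 * `|u0 x| `^ (2 * p / (p + 1)).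

Local Notation w0 := optimal_inverse.
Local Notation t0 := optimal_density.

Let p0 : 0 < p. Proof. exact: lt_trans ltr01 hp. Qed.
Let p1 : 0 < p + 1. Proof. by rewrite addr_gt0. Qed.

(** Comparison with the zero function gives J(u0) <= 0, so neither of the two nonnegative terms of
    J(u0) can be infinite. *)
Lemma minimizer_J_finite : [/\ 0 < a, A = a%:E, dirichlet Omega u0 \is a fin_num &
  J_functional Omega p f u0
  = (2^-1 * fine (dirichlet Omega u0) + 2^-1 * a `^ r - f u0)%:E].
Proof.
have [su0 min] := min0.
have q0 : 0 < 2 * p / (p + 1) by rewrite divr_gt0// mulr_gt0.
have r0 : 0 < r by rewrite divr_gt0.
have A_gt0 := minimizer_J_integral_gt0 hN mO hp df nf min0.
have D_ge0 := dirichlet_ge0 Omega u0.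
have J0 : (J_functional Omega p f u0 <= 0)%E.
  apply: le_trans (min _ (sobolev0_0 Omega hN)) _.
  rewrite /J_functional (dirichlet_ae_eq0 hN mO (sobolev0_0 Omega hN)); last exact: aeW.
  rewrite integral0_eq; last by move=> x _; rewrite normr0 powR0 ?gt_eqF.
  by rewrite poweR0r ?gt_eqF// (sobolev0_dual0 hN df) !mule0 adde0 sube0.
have h0 : (0 < (2^-1)%:E :> \bar R)%E by rewrite lte_fin invr_gt0.
have fin_sum (x y : \bar R) (z : R) : (0 <= x -> 0 <= y ->
    (2^-1)%:E * x + (2^-1)%:E * y - z%:E <= 0 -> x \is a fin_num /\ y \is a fin_num)%E.
  move=> x0 y0 xy; split.
    case: x x0 xy => [//|_|//]; rewrite gt0_muley// addye ?addye//.
    by rewrite -ltNye (lt_le_trans _ (mule_ge0 (ltW h0) y0)).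
  case: y y0 xy => [//|_|//]; rewrite gt0_muley// addey ?addye//.
  by rewrite -ltNye (lt_le_trans _ (mule_ge0 (ltW h0) x0)).
have [Dfin Afin] := fin_sum _ _ _ D_ge0 (poweR_ge0 _ _) J0.
have A_fin : A \is a fin_num.
  rewrite ge0_fin_numE ?(ltW A_gt0)//.
  by apply: (@lty_poweRy _ _ r); rewrite ?gt_eqF// -ge0_fin_numE ?poweR_ge0.
have AE : A = a%:E by rewrite fineK.
split => //; first by rewrite -lte_fin -AE.
by rewrite /J_functional [in LHS]AE poweR_EFin -{1}(fineK Dfin) -!EFinM -EFinD.
Qed.

Let a0 : 0 < a. Proof. by have [] := minimizer_J_finite. Qed.
Let AE : A = a%:E. Proof. by have [] := minimizer_J_finite. Qed.

Let mu0 : measurable_fun Omega u0.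
Proof. by have [[G []]] := min0. Qed.

Lemma optimal_potentialV x : ((U0 x)^-1 = (w0 x)%:E)%E.
Proof.
rewrite /optimal_potential /optimal_inverse; case: eqVneq => [->|u0x].
  by rewrite invey normr0 powR0 ?mulr0// gt_eqF// divr_gt0.
rewrite AE poweR_EFin -EFinM inver ifF; last first.
  by apply/negbTE; rewrite mulf_neq0// gt_eqF// powR_gt0// normr_gt0.
by rewrite invfM -!powRN opprK.
Qed.

Lemma optimal_potentialM x : (U0 x * (u0 x ^+ 2)%:E = (t0 x)%:E)%E.
Proof.
rewrite /optimal_potential /optimal_density; case: eqVneq => [->|u0x].
  rewrite expr0n/= mule0 normr0 powR0 ?mulr0// gt_eqF// divr_gt0//.
  by rewrite mulr_gt0.
rewrite AE poweR_EFin -!EFinM -mulrA; congr (_ * _)%:E.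
rewrite -(real_normK (num_real (u0 x))) -powR_mulrn// -powRD; last first.
  by rewrite normr_eq0 u0x implybT.
by congr (_ `^ _); field; rewrite gt_eqF.
Qed.

Let w0_ge0 x : 0 <= w0 x. Proof. by rewrite mulr_ge0 ?powR_ge0. Qed.
Let t0_ge0 x : 0 <= t0 x. Proof. by rewrite mulr_ge0 ?powR_ge0. Qed.

Let mw0 : measurable_fun Omega w0.
Proof. by apply: measurable_funM => //; apply: measurable_powR_comp; exact: measurableT_comp. Qed.

Let mt0 : measurable_fun Omega t0.
Proof. by apply: measurable_funM => //; apply: measurable_powR_comp; exact: measurableT_comp. Qed.

Lemma optimal_potential_mul_inv x : t0 x * w0 x = u0 x ^+ 2.
Proof.
rewrite /optimal_density /optimal_inverse mulrACA -powRD; last by rewrite (gt_eqF a0) implybT.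
rewrite subrr powRr0 mul1r -(real_normK (num_real (u0 x))).
have [->|u0x] := eqVneq (u0 x) 0.
  by rewrite normr0 expr0n/= powR0 ?mul0r// gt_eqF// divr_gt0// mulr_gt0.
rewrite -powRD; last by rewrite normr_eq0 u0x implybT.
rewrite -(powR_mulrn 2 (normr_ge0 _)); congr (_ `^ _).
by field; rewrite gt_eqF.
Qed.

Lemma integral_optimal_potentialM : (\int[mu]_(x in Omega) (t0 x)%:E = (a `^ r)%:E)%E.
Proof.
under eq_integral do rewrite EFinM.
rewrite ge0_integralZl_EFin ?powR_ge0//; last exact: measurable_powR_norm.
rewrite AE -EFinM; congr EFin.
rewrite -{2}(powRr1 (ltW a0)) -powRD; last by rewrite (gt_eqF a0) implybT.
by congr (_ `^ _); field; rewrite gt_eqF.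
Qed.

Lemma integral_optimal_potentialV : (\int[mu]_(x in Omega) (w0 x `^ p)%:E = 1)%E.
Proof.
rewrite (eq_integral (fun x => (a^-1)%:E * (`|u0 x| `^ (2 * p / (p + 1)))%:E)%E).
  rewrite ge0_integralZl_EFin ?invr_ge0 ?(ltW a0)//; last exact: measurable_powR_norm.
  by rewrite AE -EFinM mulVf// gt_eqF.
move=> x _; rewrite -EFinM; congr EFin.
rewrite /optimal_inverse powRM ?powR_ge0// -!powRrM; congr (_ * _ `^ _); last first.
  by field; rewrite gt_eqF.
by rewrite mulNr mulVf ?gt_eqF// powRN powRr1// ltW.
Qed.

Lemma energy_functional_optimal_potential :
  energy_functional Omega f U0 u0 = J_functional Omega p f u0.
Proof.
rewrite /energy_functional /J_functional; congr (_ + _ * _ - _)%E.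
under eq_integral do rewrite optimal_potentialM.
by rewrite integral_optimal_potentialM AE poweR_EFin.
Qed.

Variable V : E -> \bar R.
Hypotheses (mV : measurable_fun Omega V) (V0 : forall x, Omega x -> (0 < V x)%E).
Hypothesis V1 : (Lp_norm Omega p (fun x => (V x)^-1) <= 1)%E.

(* 1/V; the junk value 0^-1 = 0 is the right one where V = +oo. *)
Definition inverse_potential (x : E) : R := fine (V x) `^ (-1).

Local Notation w := inverse_potential.

Let w_ge0 x : 0 <= w x. Proof. exact: powR_ge0. Qed.

Let mw : measurable_fun Omega w.
Proof.
apply: measurable_powR_comp.
by apply: measurableT_comp => //; exact: fine_measurable.
Qed.

Lemma potentialV x : Omega x -> ((V x)^-1 = (w x)%:E)%E.
Proof.
move=> /V0; rewrite /inverse_potential; case: (V x) => [y|_|//]; last first.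
  by rewrite invey/= powR0// oppr_eq0 oner_eq0.
by rewrite lte_fin /= => y0; rewrite inver gt_eqF// powR_inv1// ltW.
Qed.

(** Where V = +oo, finiteness of the product forces y = 0, and both sides vanish. *)
Lemma potential_mul_inv x y : Omega x -> (V x * (y ^+ 2)%:E)%E \is a fin_num ->
  fine (V x * (y ^+ 2)%:E)%E * w x = y ^+ 2.
Proof.
move=> /V0; rewrite /inverse_potential; case: (V x) => [z|_|//].
  by rewrite lte_fin /= => z0 _; rewrite powR_inv1 ?ltW// mulrAC divff ?mul1r// gt_eqF.
have [->|y0] := eqVneq y 0; first by rewrite expr0n/= mule0 mul0r.
by rewrite gt0_mulye// lte_fin exprn_even_gt0.
Qed.

Lemma integral_potentialV_le1 : (\int[mu]_(x in Omega) (w x `^ p)%:E <= 1)%E.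
Proof.
have pn0 : p != 0 by rewrite gt_eqF.
have : (Lp_norm Omega p (fun x => (w x)%:E) <= 1)%E.
  apply: le_trans V1; rewrite le_eqVlt; apply/orP; left; apply/eqP; apply: eq_Lnorm => x.
  by rewrite !patchE; case: ifPn => // /set_mem Ox; rewrite potentialV.
rewrite Lp_norm_EFin (Lnorm_restrict _ _ _ pn0).
under eq_integral do rewrite (ger0_norm (w_ge0 _)).
set I' := (\int[mu]_(x in Omega) _)%E => I1.
have I'0 : (0 <= I')%E by apply: integral_ge0 => x _; rewrite lee_fin powR_ge0.
have : ((I' `^ p^-1) `^ p <= 1 `^ p)%E.
  by apply: gt0_ler_poweR; rewrite ?in_itv/= ?leey ?poweR_ge0 ?lee_fin ?ler01// ltW.
by rewrite -poweRrM mulVf// poweRe1// poweR1r.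
Qed.

Lemma Lp_norm_potentialV_sub (X : R) : 0 <= X ->
  (\int[mu]_(x in Omega) (`|w x - w0 x| `^ p)%:E = X%:E)%E ->
  (Lp_norm Omega p (fun x => (V x)^-1 - (U0 x)^-1)%E = (X `^ p^-1)%:E)%E.
Proof.
move=> X0 IX; have pn0 : p != 0 by rewrite gt_eqF.
rewrite (_ : Lp_norm _ _ _ = Lp_norm Omega p (fun x => (w x - w0 x)%:E)).
  by rewrite Lp_norm_EFin (Lnorm_restrict _ _ _ pn0) IX poweR_EFin.
apply: eq_Lnorm => x; rewrite !patchE; case: ifPn => // /set_mem Ox.
by rewrite potentialV// optimal_potentialV.
Qed.

Lemma energy_functional_gap (Z : R) u : 0 <= Z -> sobolev0 Omega u ->
  (\int[mu]_(x in Omega) (((w x + w0 x) / 2) `^ p)%:E = Z%:E)%E ->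
  Z `^ p^-1 <= 1 ->
  (J_functional Omega p f u0 + (2^-1 * a `^ r * (1 - Z `^ p^-1))%:E
   <= energy_functional Omega f V u)%E.
Proof.
move=> Z0 su IZ Z1; have [su0 min] := min0.
have [_ _ D0fin ->] := minimizer_J_finite.
have [G [mu_ _ _]] := su.
have D_ge0 := dirichlet_ge0 Omega u.
have vu0 x : Omega x -> (0 <= V x * (u x ^+ 2)%:E)%E.
  by move=> Ox; rewrite mule_ge0 ?lee_fin ?sqr_ge0// ltW// V0.
have mvu : measurable_fun Omega (fun x => (V x * (u x ^+ 2)%:E)%E).
  by apply: emeasurable_funM => //; apply/measurable_EFinP; exact: measurable_funX.
rewrite /energy_functional; set I := (\int[mu]_(x in Omega) (V x * _))%E.
have I_ge0 : (0 <= I)%E by exact: integral_ge0.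
have h0 : (0 < (2^-1)%:E :> \bar R)%E by rewrite lte_fin invr_gt0.
have [Dfin|] := boolP (dirichlet Omega u \is a fin_num); last first.
  rewrite ge0_fin_numE// -leNgt leye_eq => /eqP ->.
  rewrite gt0_muley// addye ?addye ?leey//.
  by rewrite -ltNye (lt_le_trans _ (mule_ge0 (ltW h0) I_ge0)).
have [Ifin|] := boolP (I \is a fin_num); last first.
  rewrite ge0_fin_numE// -leNgt leye_eq => /eqP ->.
  rewrite gt0_muley// addey ?addye ?leey//.
  by rewrite -ltNye (lt_le_trans _ (mule_ge0 (ltW h0) D_ge0)).
pose t x := fine (V x * (u x ^+ 2)%:E)%E.
have mt : measurable_fun Omega t.
  by apply: measurableT_comp => //; exact: fine_measurable.
have t_ge0 x : Omega x -> 0 <= t x by move=> Ox; rewrite fine_ge0// vu0.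
(* A finite integral gives a finite integrand only almost everywhere; this is why [hoelder_quotient]
   assumes its pointwise bound almost everywhere. *)
have vu_ae : {ae mu, forall x, Omega x -> (V x * (u x ^+ 2)%:E)%E \is a fin_num}.
  apply: (integrable_ae mO); apply/integrableP; split => //.
  under eq_integral => x /set_mem Ox do rewrite gee0_abs ?vu0//.
  by rewrite -/I -ge0_fin_numE.
have It : (\int[mu]_(x in Omega) (t x)%:E = I)%E.
  apply: ae_eq_integral => //; first exact/measurable_EFinP.
  by apply: filterS vu_ae => x vux Ox; rewrite /t fineK// vux.
have [sm Dm] := sobolev0_midpoint hN mO su su0.
have := min _ sm; set m := fun x => 2^-1 * u x + 2^-1 * u0 x.
have mm : measurable_fun Omega m.
  by apply: measurable_funD; exact: measurable_funM.
(* The integral of the averaged densities V u^2 and U0 u0^2 takes the role of int m^2/z, with z the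
   average of 1/V and 1/U0; Titu's inequality supplies the pointwise bound. *)
have := @hoelder_quotient _ _ _ mu Omega mO p m (fun x => 2^-1 * t x + 2^-1 * t0 x)
  (fun x => (w x + w0 x) / 2) hp mm.
rewrite IZ poweR_EFin.
have -> : (\int[mu]_(x in Omega) (2^-1 * t x + 2^-1 * t0 x)%:E
    = (2^-1 * fine I + 2^-1 * a `^ r)%:E)%E.
  under eq_integral do rewrite EFinD !EFinM.
  have h0' : 0 <= 2^-1 :> R by rewrite invr_ge0.
  rewrite (ge0_integral_linear mu mO h0' h0' (F1 := EFin \o t) (F2 := EFin \o t0)).
  - by rewrite /= It integral_optimal_potentialM EFinD !EFinM fineK.
  - exact/measurable_EFinP.
  - exact/measurable_EFinP.
  - by move=> x Ox; rewrite lee_fin t_ge0.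
  - by move=> x _; rewrite lee_fin.
rewrite -EFinM => /(_ _ _ _ _ _)/wrap[].
- by apply: measurable_funD; exact: measurable_funM.
- by apply: measurable_funM => //; exact: measurable_funD.
- by move=> x Ox; rewrite addr_ge0// mulr_ge0 ?invr_ge0 ?t_ge0.
- by move=> x Ox; rewrite divr_ge0// addr_ge0.
- apply: filterS vu_ae => x vux Ox; apply: sqr_midpoint_le => //.
  + exact: t_ge0.
  + by apply: potential_mul_inv => //; exact: vux.
  + exact: optimal_potential_mul_inv.
move=> m_le; have [_ _ _ ->] := minimizer_J_finite; rewrite /J_functional.
rewrite (sobolev0_dual_midpoint hN mO df)// => J_le.
exact: midpoint_gap_arith Dfin D0fin Ifin I_ge0 Z1 Dm m_le J_le.
Qed.

(** Positivity of c2 is part of the conclusion because it makes the rate c2^2 times [stability_rate]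
    positive. *)
Lemma energy_stability :
  let c2 := Lp_norm Omega (2 * p / (p + 1)) (fun x => (u0 x)%:E) in
  ((fine c2 ^+ 2 * stability_rate p)%:E
   * Lp_norm Omega p (fun x => (V x)^-1 - (U0 x)^-1) `^ (2 * p * (p + 1) / (p - 1))
   <= energy Omega f V - energy Omega f U0)%E /\ 0 < fine c2.
Proof.
move=> c2.
have q0 : 0 < 2 * p / (p + 1) by rewrite divr_gt0// mulr_gt0.
have p_gt1 : 0 < p - 1 by rewrite subr_gt0.
have c2E : c2 = (a `^ (2 * p / (p + 1))^-1)%:E.
  by rewrite /c2 Lp_norm_EFin (Lnorm_restrict _ _ _ (lt0r_neq0 q0)) AE poweR_EFin.
split; last by rewrite c2E powR_gt0.
have c2r : fine c2 ^+ 2 = a `^ r.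
  rewrite c2E /= -(powR_mulrn 2 (powR_ge0 _ _)) -powRrM; congr (_ `^ _).
  by field; rewrite !gt_eqF// mulr_gt0.
have w0_le1 : (\int[mu]_(x in Omega) (w0 x `^ p)%:E <= 1)%E.
  by rewrite integral_optimal_potentialV.
have [X [Z [X02 Z0 IX IZ gap]]] := integral_powR_midpoint_gap mO hp mw mw0
  (fun x _ => w_ge0 x) (fun x _ => w0_ge0 x) integral_potentialV_le1 w0_le1.
have rate := stability_rate_le hp X02 Z0 gap; have [X0 _] := andP X02.
(* Read off from [rate], whose left-hand side is nonnegative. *)
have Z1 : Z `^ p^-1 <= 1.
  have : 0 <= 2^-1 * (1 - Z `^ p^-1).
    by apply: le_trans rate; rewrite mulr_ge0 ?powR_ge0// ltW// stability_rate_gt0.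
  by rewrite pmulr_rge0 ?invr_gt0// subr_ge0.
rewrite (Lp_norm_potentialV_sub X0 IX) poweR_EFin -powRrM.
rewrite (_ : p^-1 * _ = 2 * (p + 1) / (p - 1)); last by field; rewrite !gt_eqF.
rewrite c2r -EFinM; set s := _ * stability_rate p * _.
have [_ _ _ JE] := minimizer_J_finite.
have J_fin : J_functional Omega p f u0 \is a fin_num by rewrite JE.
have EV : (J_functional Omega p f u0 + s%:E <= energy Omega f V)%E.
  apply/ereal_infP => _ [u su <-]; apply: le_trans (energy_functional_gap Z0 su IZ Z1).
  apply: leeD => //; rewrite lee_fin /s -mulrA [leRHS]mulrAC [leRHS]mulrC.
  by apply: ler_wpM2l => //; exact: powR_ge0.
have EU : (energy Omega f U0 <= J_functional Omega p f u0)%E.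
  apply: ge_ereal_inf; exists (energy_functional Omega f U0 u0).
    by exists u0 => //; have [] := min0.
  by rewrite energy_functional_optimal_potential.
apply: le_trans (leeB EV EU).
by rewrite addeAC subee// add0e.
Qed.

End potentials.

Theorem theorem6p6 (R : realType) (N : nat) (hN : (3 <= N)%N)
    (p : R) (hp : 1 < p) :
  exists sigma_m : R -> R -> R -> R,
    (forall a b c : R, 0 < sigma_m a b c) /\
    forall (Omega : set 'rV[R]_N) (f : ('rV[R]_N -> R) -> R)
           (u0 : 'rV[R]_N -> R),
      open Omega ->
      sobolev0_dual Omega f -> dual_nonzero Omega f ->
      is_minimizer_J Omega p f u0 ->
      let U0 := optimal_potential Omega p u0 in
      let c2 := Lp_norm Omega (2 * p / (p + 1)) (fun x => (u0 x)%:E) in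
      let c4 := Lp_norm Omega (@crit_exp_conj R N)
                  (fun x => (`|u0 x| `^ ((p - 1) / (p + 1)))%:E) in
      (c4 < +oo)%E ->
      forall V : 'rV[R]_N -> \bar R,
        measurable_fun Omega V ->
        (forall x, Omega x -> (0 < V x)%E) ->
        (Lp_norm Omega p (fun x => (V x)^-1) <= 1)%E ->
        ((sigma_m (fine c2) (fine c4) (fine (dual_norm Omega f)))%:E
         * Lp_norm Omega p (fun x => (V x)^-1 - (U0 x)^-1)
             `^ (2 * p * (p + 1) / (p - 1))
         <= energy Omega f V - energy Omega f U0)%E.
Proof.
(* The witness has to be positive at all real arguments, hence the default 1. For a minimizer c2 is
   positive, and the first branch applies. *)
exists (fun c2 _ _ => if 0 < c2 then c2 ^+ 2 * stability_rate p else 1); split.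
  move=> c2 _ _; case: ifPn => // c2_gt0.
  by rewrite mulr_gt0 ?exprn_gt0// stability_rate_gt0.
move=> Omega f u0 /open_measurable_mx mO df nf min0 U0 c2 c4 _ V mV V0 V1.
have [E c2_gt0] := energy_stability hN mO hp df nf min0 mV V0 V1.
by rewrite c2_gt0; exact: E.
Qed.
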